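(* Let $(X,\mathcal O)$ be a finite space. Then the kernel of any morphism between quasi-coherent $\mathcal O$-modules is also quasi-coherent. Moreover, if $$0\to\mathcal M'\to\mathcal M\to\mathcal M''\to0$$ is an exact sequence of $\mathcal O$-modules and two of them are quasi-coherent, then the third is quasi-coherent too. In particular, the category of quasi-coherent $\mathcal O$-modules on a finite space is an abelian subcategory of the category of $\mathcal O$-modules.
   Context: All rings are commutative with unit. A ringed finite space is a ringed space $(X,\mathcal O)$ with $X$ a finite topological space. For $p\in X$, $U_p$ is the smallest open subset containing $p$; $p\le q$ means $q\in U_p$. The stalk is $\mathcal O_p=\mathcal O(U_p)$, with restriction morphisms $\mathcal O_p\to\mathcal O_q$ for $p\le q$. A finite space is a ringed finite space all of whose restriction morphisms $\mathcal O_p\to\mathcal O_q$ ($p\le q$) are flat. An $\mathcal O$-module is quasi-coherent if it is locally a cokernel of a morphism between free modules of arbitrary rank. *)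

(* Defs.v *)
(* Rings are comPzRingType, not comNzRingType: the zero ring must be allowed, if
   only because it is the ring of sections over the empty set. *)
From HB Require Import structures.
From mathcomp Require Import all_boot all_order all_algebra.
From mathcomp Require Import all_classical.
From mathcomp Require Import topology.

Set Implicit Arguments.
Unset Strict Implicit.
Unset Printing Implicit Defensive.

Import GRing.Theory.
Local Open Scope classical_set_scope.
Local Open Scope quotient_scope.
Local Open Scope ring_scope.

(* Formal sums of pairs are lists; [tensor_rel] is the congruence generated by
   commutativity of addition and bilinearity. *)
Inductive tensor_rel (A : comPzRingType) (M N : lmodType A) :
    seq (M * N) -> seq (M * N) -> Prop :=
  | trel_refl s : tensor_rel s s
  | trel_sym s t : tensor_rel s t -> tensor_rel t s
  | trel_trans s t u : tensor_rel s t -> tensor_rel t u -> tensor_rel s u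
  | trel_cat s s' t t' :
      tensor_rel s s' -> tensor_rel t t' -> tensor_rel (s ++ t) (s' ++ t')
  | trel_catC s t : tensor_rel (s ++ t) (t ++ s)
  | trel_addl m m' n : tensor_rel [:: (m + m', n)] [:: (m, n); (m', n)]
  | trel_addr m n n' : tensor_rel [:: (m, n + n')] [:: (m, n); (m, n')]
  | trel_scale a m n : tensor_rel [:: (a *: m, n)] [:: (m, a *: n)]
  | trel_zero n : tensor_rel [:: (0, n)] [::].

Section Tensor.
Variables (A : comPzRingType) (M N : lmodType A).

Definition tensor_relb (s t : seq (M * N)) : bool := `[< tensor_rel s t >].

Lemma tensor_relb_refl : reflexive tensor_relb.
Proof. by move=> s; apply/asboolP; exact: trel_refl. Qed.

Lemma tensor_relb_sym : symmetric tensor_relb.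
Proof. by move=> s t; apply/asboolP/asboolP; exact: trel_sym. Qed.

Lemma tensor_relb_trans : transitive tensor_relb.
Proof.
by move=> t s u /asboolP st /asboolP tu; apply/asboolP; exact: trel_trans st tu.
Qed.

Canonical tensor_equiv :=
  EquivRel tensor_relb tensor_relb_refl tensor_relb_sym tensor_relb_trans.

Definition tensor : Type := {eq_quot tensor_equiv}.
HB.instance Definition _ := Choice.on tensor.

Definition tclass (s : seq (M * N)) : tensor := \pi_({eq_quot tensor_equiv}) s.
Definition trepr (x : tensor) : seq (M * N) :=
  repr (x : {eq_quot tensor_equiv}).

Lemma treprK x : tclass (trepr x) = x.
Proof. exact: reprK. Qed.

Lemma tclassP s t : tclass s = tclass t <-> tensor_rel s t.
Proof.
split=> [/eqquotP|st]; first by move/asboolP.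
by apply/eqquotP/asboolP.
Qed.

Lemma trepr_class s : tensor_rel (trepr (tclass s)) s.
Proof. by apply/tclassP; rewrite treprK. Qed.

Definition tpure (m : M) (n : N) : tensor := tclass [:: (m, n)].
Definition tzero : tensor := tclass [::].
Definition tadd (x y : tensor) : tensor := tclass (trepr x ++ trepr y).
Definition sscale (a : A) (s : seq (M * N)) : seq (M * N) :=
  [seq (a *: mn.1, mn.2) | mn <- s].
Definition tscale (a : A) (x : tensor) : tensor := tclass (sscale a (trepr x)).

Lemma taddE s t : tadd (tclass s) (tclass t) = tclass (s ++ t).
Proof. by apply/tclassP; apply: trel_cat; exact: trepr_class. Qed.

Lemma tscale_compat a s t : tensor_rel s t ->
  tensor_rel (sscale a s) (sscale a t).
Proof.
rewrite /sscale; elim=> {s t} //=.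
- by move=> s; exact: trel_refl.
- by move=> s t _; exact: trel_sym.
- by move=> s t u _ st _; exact: trel_trans.
- by move=> s s' t t' _ ss' _ tt'; rewrite !map_cat; exact: trel_cat.
- by move=> s t; rewrite !map_cat; exact: trel_catC.
- by move=> m m' n; rewrite scalerDr; exact: trel_addl.
- by move=> m n n'; exact: trel_addr.
- move=> b m n; rewrite scalerA mulrC -scalerA; exact: trel_scale.
- by move=> n; rewrite scaler0; exact: trel_zero.
Qed.

Lemma tscaleE a s :
  tscale a (tclass s) = tclass (sscale a s).
Proof. by apply/tclassP; apply: tscale_compat; exact: trepr_class. Qed.

Lemma taddA : associative tadd.
Proof.
move=> x y z; rewrite -(treprK x) -(treprK y) -(treprK z).
by rewrite !taddE catA.
Qed.

Lemma taddC : commutative tadd.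
Proof.
move=> x y; rewrite -(treprK x) -(treprK y) !taddE.
by apply/tclassP; exact: trel_catC.
Qed.

Lemma tadd0 : left_id tzero tadd.
Proof. by move=> x; rewrite -(treprK x) taddE. Qed.

Lemma tscaleDl x a b : tscale (a + b) x = tadd (tscale a x) (tscale b x).
Proof.
rewrite -(treprK x) !tscaleE taddE; apply/tclassP.
elim: (trepr x) => [|[m n] s IH] /=; first exact: trel_refl.
have e : tensor_rel [:: ((a + b) *: m, n)] [:: (a *: m, n); (b *: m, n)].
  by rewrite scalerDl; exact: trel_addl.
apply: (trel_trans (trel_cat e IH)).
rewrite -[_ :: sscale b s]cat1s -[_ :: sscale a s ++ _]cat1s -[[:: _; _]]cat1s.
rewrite -catA; apply: trel_cat; first exact: trel_refl.
rewrite !catA; apply: trel_cat; last exact: trel_refl.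
exact: trel_catC.
Qed.

Lemma tscaleDr a : {morph tscale a : x y / tadd x y}.
Proof.
move=> x y; rewrite -(treprK x) -(treprK y) !(taddE, tscaleE).
by rewrite /sscale map_cat.
Qed.

Lemma tscaleA a b x : tscale a (tscale b x) = tscale (a * b) x.
Proof.
rewrite -(treprK x) !tscaleE /sscale -map_comp; congr tclass.
by apply: eq_map => -[m n] /=; rewrite scalerA.
Qed.

Lemma tscale1 : left_id 1 tscale.
Proof.
move=> x; rewrite -[in LHS](treprK x) tscaleE -[RHS](treprK x); congr tclass.
by rewrite /sscale -[RHS]map_id; apply: eq_map => -[m n] /=; rewrite scale1r.
Qed.

Lemma tscale0 x : tscale 0 x = tzero.
Proof.
rewrite -(treprK x) tscaleE; apply/tclassP.
elim: (trepr x) => [|[m n] s IH] /=; first exact: trel_refl.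
rewrite -cat1s -[[::]]cats0 scale0r.
by apply: trel_cat IH; exact: trel_zero.
Qed.

Lemma taddN : left_inverse tzero (tscale (-1)) tadd.
Proof. by move=> x; rewrite -[X in tadd _ X]tscale1 -tscaleDl addNr tscale0. Qed.

HB.instance Definition _ := GRing.isZmodule.Build tensor taddA taddC tadd0 taddN.
HB.instance Definition _ := GRing.Zmodule_isLmodule.Build A tensor
  tscaleA tscale1 tscaleDr tscaleDl.

End Tensor.

Section TensorMap.
Variables (A : comPzRingType) (M M' N : lmodType A) (f : {linear M -> M'}).

(* f (x) id_N *)
Definition smap (s : seq (M * N)) : seq (M' * N) :=
  [seq (f mn.1, mn.2) | mn <- s].
Definition tensor_map (x : tensor M N) : tensor M' N := tclass (smap (trepr x)).

Lemma smap_compat s t : tensor_rel s t -> tensor_rel (smap s) (smap t).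
Proof.
rewrite /smap; elim=> {s t} //=.
- by move=> s; exact: trel_refl.
- by move=> s t _; exact: trel_sym.
- by move=> s t u _ st _; exact: trel_trans.
- by move=> s s' t t' _ ss' _ tt'; rewrite !map_cat; exact: trel_cat.
- by move=> s t; rewrite !map_cat; exact: trel_catC.
- by move=> m m' n; rewrite linearD; exact: trel_addl.
- by move=> m n n'; exact: trel_addr.
- by move=> b m n; rewrite linearZ; exact: trel_scale.
- by move=> n; rewrite linear0; exact: trel_zero.
Qed.

Lemma tensor_mapE s : tensor_map (tclass s) = tclass (smap s).
Proof. by apply/tclassP; apply: smap_compat; exact: trepr_class. Qed.

Lemma tensor_map_pure m n : tensor_map (tpure m n) = tpure (f m) n.
Proof. exact: tensor_mapE. Qed.

Lemma tensor_map_is_linear : linear tensor_map.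
Proof.
move=> a x y; rewrite -(treprK x) -(treprK y).
rewrite [a *: _]tscaleE [_ + _]taddE !tensor_mapE.
rewrite [a *: _]tscaleE [RHS]taddE /smap map_cat; congr (tclass (_ ++ _)).
by rewrite /sscale -!map_comp; apply: eq_map => -[m n] /=; rewrite linearZ.
Qed.

HB.instance Definition _ :=
  GRing.isLinear.Build A (tensor M N) (tensor M' N) _ tensor_map
    tensor_map_is_linear.

End TensorMap.

(* The universal property, as a check on the construction above. *)
Lemma tensor_universal (A : comPzRingType) (M N T : lmodType A)
    (b : M -> N -> T) :
    (forall n, linear (fun m => b m n)) -> (forall m, linear (b m)) ->
  exists! g : tensor M N -> T, linear g /\ forall m n, g (tpure m n) = b m n.
Proof.
move=> bl br.
have blD m m' n : b (m + m') n = b m n + b m' n.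
  by have := bl n 1 m m'; rewrite !scale1r.
have brD m n n' : b m (n + n') = b m n + b m n'.
  by have := br m 1 n n'; rewrite !scale1r.
have bl0 n : b 0 n = 0 by apply: (addrI (b 0 n)); rewrite -blD !addr0.
have br0 m : b m 0 = 0 by apply: (addrI (b m 0)); rewrite -brD !addr0.
have blZ a m n : b (a *: m) n = a *: b m n.
  by have := bl n a m 0; rewrite !addr0 bl0 addr0.
have brZ a m n : b m (a *: n) = a *: b m n.
  by have := br m a n 0; rewrite !addr0 br0 addr0.
pose G (s : seq (M * N)) := \sum_(mn <- s) b mn.1 mn.2.
have Grel s t : tensor_rel s t -> G s = G t.
  elim=> {s t} //=.
  - by move=> s t u _ -> _ ->.
  - by move=> s s' t t' _ + _; rewrite /G !big_cat /= => -> ->.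
  - by move=> s t; rewrite /G !big_cat /= addrC.
  - by move=> m m' n; rewrite /G !big_cons !big_nil /= blD !addr0.
  - by move=> m n n'; rewrite /G !big_cons !big_nil /= brD !addr0.
  - by move=> a m n; rewrite /G !big_cons !big_nil /= blZ brZ.
  - by move=> n; rewrite /G !big_cons !big_nil /= bl0 addr0.
have GE s : G (trepr (tclass s)) = G s by apply: Grel; exact: trepr_class.
exists (fun x => G (trepr x)); split; [split|].
- move=> a x y; rewrite -{1}(treprK x) -{1}(treprK y).
  rewrite [a *: _]tscaleE [_ + _]taddE GE /G big_cat big_map scaler_sumr.
  by congr (_ + _); apply: eq_bigr => i _; rewrite blZ.
- by move=> m n; rewrite GE /G big_cons big_nil /= addr0.
move=> g [gl gb]; apply/funext => x; rewrite -{2}(treprK x).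
have gD y z : g (y + z) = g y + g z by have := gl 1 y z; rewrite !scale1r.
have g0 : g 0 = 0 by apply: (addrI (g 0)); rewrite -gD !addr0.
elim: (trepr x) => [|[m n] s IH]; first by rewrite /G big_nil [RHS]g0.
rewrite -cat1s -taddE [RHS]gD /G big_cat -/(G s) IH; congr (_ + _).
by rewrite big_cons big_nil /= addr0 -gb.
Qed.

(* B seen as an A-module along phi *)
Definition restrict_scalars (A B : comPzRingType) (phi : {rmorphism A -> B}) :
  Type := B.

Section RestrictionOfScalars.
Variables (A B : comPzRingType) (phi : {rmorphism A -> B}).
Local Notation B_A := (restrict_scalars phi).

HB.instance Definition _ := GRing.Zmodule.copy B_A B.

Definition rscale (a : A) (b : B_A) : B_A :=
  phi a * (b : B).

Lemma rscaleA a b v : rscale a (rscale b v) = rscale (a * b) v.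
Proof. by rewrite /rscale rmorphM mulrA. Qed.
Lemma rscale1 : left_id 1 rscale.
Proof. by move=> v; rewrite /rscale rmorph1 mul1r. Qed.
Lemma rscaleDr : right_distributive rscale +%R.
Proof. by move=> a u v; rewrite /rscale mulrDr. Qed.
Lemma rscaleDl v : {morph rscale^~ v : a b / a + b}.
Proof. by move=> a b; rewrite /rscale rmorphD mulrDl. Qed.

HB.instance Definition _ := GRing.Zmodule_isLmodule.Build A B_A
  rscaleA rscale1 rscaleDr rscaleDl.

Definition is_flat : Prop :=
  forall (M1 M2 M3 : lmodType A) (f : {linear M1 -> M2}) (g : {linear M2 -> M3}),
    (forall y, g y = 0 <-> exists x, f x = y) ->
    forall y : tensor M2 B_A,
      tensor_map g y = 0 <-> exists x, tensor_map f x = y.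

End RestrictionOfScalars.

(* categories with zero morphisms *)
Record category := Category {
  obj :> Type;
  homc : obj -> obj -> Type;
  idc : forall A, homc A A;
  compc : forall A B C, homc B C -> homc A B -> homc A C;
  zeroc : forall A B, homc A B;
  compA : forall A B C D (h : homc C D) (g : homc B C) (f : homc A B),
    compc h (compc g f) = compc (compc h g) f;
  comp1f : forall A B (f : homc A B), compc (idc B) f = f;
  compf1 : forall A B (f : homc A B), compc f (idc A) = f;
  comp0f : forall A B C (f : homc A B), compc (zeroc B C) f = zeroc A C;
  compf0 : forall A B C (f : homc B C), compc f (zeroc A B) = zeroc A C }.

Arguments zeroc {c A B}.

Section CategoricalNotions.
Variable C : category.
Implicit Types A B P K : C.

Definition is_zero_object (Z : C) : Prop :=
  (forall A, exists! f : homc A Z, True) /\ (forall A, exists! f : homc Z A, True).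

Definition is_product A B P (p : homc P A) (q : homc P B) : Prop :=
  forall T (f : homc T A) (g : homc T B),
    exists! h : homc T P, compc p h = f /\ compc q h = g.

Definition is_coproduct A B P (i : homc A P) (j : homc B P) : Prop :=
  forall T (f : homc A T) (g : homc B T),
    exists! h : homc P T, compc h i = f /\ compc h j = g.

Definition is_kernel A B K (f : homc A B) (k : homc K A) : Prop :=
  compc f k = zeroc /\
  forall T (t : homc T A), compc f t = zeroc -> exists! h : homc T K, compc k h = t.

Definition is_cokernel A B K (f : homc A B) (c : homc B K) : Prop :=
  compc c f = zeroc /\
  forall T (t : homc B T), compc t f = zeroc -> exists! h : homc K T, compc h c = t.

Definition is_mono A B (f : homc A B) : Prop :=
  forall T (g h : homc T A), compc f g = compc f h -> g = h.

Definition is_epi A B (f : homc A B) : Prop :=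
  forall T (g h : homc B T), compc g f = compc h f -> g = h.

(* The addition of morphisms is not part of the data: in a category with these
   properties it exists and is unique. *)
Record abelian_category : Prop := Abelian {
  abelian_zero : exists Z : C, is_zero_object Z;
  abelian_product : forall A B,
    exists P (p : homc P A) (q : homc P B), is_product p q;
  abelian_coproduct : forall A B,
    exists P (i : homc A P) (j : homc B P), is_coproduct i j;
  abelian_kernel : forall A B (f : homc A B),
    exists K (k : homc K A), is_kernel f k;
  abelian_cokernel : forall A B (f : homc A B),
    exists K (c : homc B K), is_cokernel f c;
  abelian_mono : forall A B (f : homc A B), is_mono f ->
    exists D (g : homc B D), is_kernel g f;
  abelian_epi : forall A B (f : homc A B), is_epi f ->
    exists D (g : homc D A), is_cokernel g f }.

Definition full_subcategory (P : C -> Prop) : category :=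
  let T := {A : C | P A} in
  @Category T (fun A B : T => homc (sval A) (sval B))
    (fun A : T => idc (sval A))
    (fun A B D : T => @compc C (sval A) (sval B) (sval D))
    (fun A B : T => @zeroc C (sval A) (sval B))
    (fun A B D E : T => @compA C (sval A) (sval B) (sval D) (sval E))
    (fun A B : T => @comp1f C (sval A) (sval B))
    (fun A B : T => @compf1 C (sval A) (sval B))
    (fun A B D : T => @comp0f C (sval A) (sval B) (sval D))
    (fun A B D : T => @compf0 C (sval A) (sval B) (sval D)).

End CategoricalNotions.

(* The full subcategory on P is abelian and its inclusion is exact: it preserves
   finite products and coproducts, kernels and cokernels. *)
Record abelian_subcategory (C : category) (P : C -> Prop) : Prop :=
  AbelianSubcategory {
  absub_abelian : abelian_category (full_subcategory P);
  absub_zero : forall Z : full_subcategory P,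
    is_zero_object Z -> is_zero_object (sval Z);
  absub_product : forall (A B Q : full_subcategory P) (p : homc Q A) (q : homc Q B),
    is_product p q -> is_product (C := C) (p : homc (sval Q) (sval A)) q;
  absub_coproduct : forall (A B Q : full_subcategory P) (i : homc A Q) (j : homc B Q),
    is_coproduct i j -> is_coproduct (C := C) (i : homc (sval A) (sval Q)) j;
  absub_kernel : forall (A B K : full_subcategory P) (f : homc A B) (k : homc K A),
    is_kernel f k -> is_kernel (C := C) (f : homc (sval A) (sval B)) k;
  absub_cokernel : forall (A B K : full_subcategory P) (f : homc A B) (c : homc B K),
    is_cokernel f c -> is_cokernel (C := C) (f : homc (sval A) (sval B)) c }.

Record opens (X : topologicalType) := Opens {
  carrier :> set X;
  carrier_open : open carrier }.

Lemma opens_eq (X : topologicalType) (U V : opens X) :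
  carrier U = carrier V -> U = V.
Proof.
by case: U V => [U oU] [V oV] /= UV; subst V; congr Opens; exact: Prop_irrelevance.
Qed.

Definition is_sheaf (X : topologicalType) (F : opens X -> Type)
    (res : forall U V : opens X, V `<=` U -> F U -> F V) : Prop :=
  forall (U : opens X) (I : Type) (V : I -> opens X)
    (VU : forall i, V i `<=` U), U `<=` \bigcup_i V i ->
  forall s : forall i, F (V i),
    (forall i j (W : opens X) (Wi : W `<=` V i) (Wj : W `<=` V j),
       res _ _ Wi (s i) = res _ _ Wj (s j)) ->
  exists! t : F U, forall i, res _ _ (VU i) t = s i.

Record ring_sheaf (X : topologicalType) := RingSheaf {
  rsec :> opens X -> comPzRingType;
  rres : forall U V : opens X, V `<=` U -> {rmorphism rsec U -> rsec V};
  rres_id : forall (U : opens X) (UU : U `<=` U) s, rres UU s = s;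
  rres_comp : forall (U V W : opens X) (VU : V `<=` U) (WV : W `<=` V)
    (WU : W `<=` U) s, rres WV (rres VU s) = rres WU s;
  rsec_sheaf : is_sheaf (fun U V VU => @rres U V VU) }.

Section Modules.
Variables (X : topologicalType) (O : ring_sheaf X).

Record mod_sheaf := ModSheaf {
  msec :> forall U : opens X, lmodType (O U);
  mres : forall U V : opens X, V `<=` U -> msec U -> msec V;
  mresD : forall (U V : opens X) (VU : V `<=` U) (s t : msec U),
    mres VU (s + t) = mres VU s + mres VU t;
  mresZ : forall (U V : opens X) (VU : V `<=` U) (a : O U) (s : msec U),
    mres VU (a *: s) = rres O VU a *: mres VU s;
  mres_id : forall (U : opens X) (UU : U `<=` U) s, mres UU s = s;
  mres_comp : forall (U V W : opens X) (VU : V `<=` U) (WV : W `<=` V)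
    (WU : W `<=` U) s, mres WV (mres VU s) = mres WU s;
  msec_sheaf : is_sheaf mres }.

Lemma mres0 (M : mod_sheaf) (U V : opens X) (VU : V `<=` U) :
  mres VU (0 : M U) = 0.
Proof. by apply: (addrI (mres VU 0)); rewrite -mresD !addr0. Qed.

Record mod_hom (M N : mod_sheaf) := ModHom {
  happ :> forall U : opens X, M U -> N U;
  happ_linear : forall U, linear (happ (U := U));
  happ_res : forall (U V : opens X) (VU : V `<=` U) s,
    happ (mres VU s) = mres VU (happ s) }.

HB.instance Definition _ (M N : mod_sheaf) (f : mod_hom M N) (U : opens X) :=
  GRing.isLinear.Build (O U) (M U) (N U) _ (@happ M N f U)
    (@happ_linear M N f U).

Lemma mod_hom_eq (M N : mod_sheaf) (f g : mod_hom M N) :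
  (forall U (s : M U), f U s = g U s) -> f = g.
Proof.
case: f g => [f fl fr] [g gl gr] /= fg.
have e : f = g by apply: functional_extensionality_dep => U; apply/funext.
by subst g; congr ModHom; exact: Prop_irrelevance.
Qed.

Definition mod_id (M : mod_sheaf) : mod_hom M M :=
  @ModHom M M (fun U s => s) (fun U a s t => erefl) (fun U V VU s => erefl).

Section Composition.
Variables (M N P : mod_sheaf) (g : mod_hom N P) (f : mod_hom M N).

Definition comp_app (U : opens X) (s : M U) : P U := g U (f U s).
Lemma comp_linear U : linear (comp_app (U := U)).
Proof. by move=> a s t; rewrite /comp_app !linearP. Qed.
Lemma comp_res (U V : opens X) (VU : V `<=` U) s :
  comp_app (mres VU s) = mres VU (comp_app s).
Proof. by rewrite /comp_app (happ_res f) (happ_res g). Qed.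

Definition mod_comp : mod_hom M P := ModHom comp_linear comp_res.

End Composition.

Section Zero.
Variables M N : mod_sheaf.

Definition zero_app (U : opens X) (s : M U) : N U := 0.
Lemma zero_linear U : linear (zero_app (U := U)).
Proof. by move=> a s t; rewrite /zero_app scaler0 addr0. Qed.
Lemma zero_res (U V : opens X) (VU : V `<=` U) s :
  zero_app (mres VU s) = mres VU (zero_app s).
Proof. by rewrite /zero_app mres0. Qed.

Definition mod_zero : mod_hom M N := ModHom zero_linear zero_res.

End Zero.

Lemma mod_comp0f (M N P : mod_sheaf) (f : mod_hom M N) :
  mod_comp (mod_zero N P) f = mod_zero M P.
Proof. exact: mod_hom_eq. Qed.

Lemma mod_compf0 (M N P : mod_sheaf) (f : mod_hom N P) :
  mod_comp f (mod_zero M N) = mod_zero M P.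
Proof. by apply: mod_hom_eq => U s; exact: linear0. Qed.

Lemma mod_compA (M N P Q : mod_sheaf) (h : mod_hom P Q) (g : mod_hom N P)
    (f : mod_hom M N) : mod_comp h (mod_comp g f) = mod_comp (mod_comp h g) f.
Proof. exact: mod_hom_eq. Qed.

Lemma mod_comp1f (M N : mod_sheaf) (f : mod_hom M N) :
  mod_comp (mod_id N) f = f.
Proof. exact: mod_hom_eq. Qed.

Lemma mod_compf1 (M N : mod_sheaf) (f : mod_hom M N) :
  mod_comp f (mod_id M) = f.
Proof. exact: mod_hom_eq. Qed.

Definition mod_cat : category :=
  Category mod_compA mod_comp1f mod_compf1 mod_comp0f mod_compf0.

Section Kernel.
Variables (M N : mod_sheaf) (f : mod_hom M N).

Definition ker_pred (U : opens X) : {pred M U} := fun s => f U s == 0.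

Lemma ker_submod U : submod_closed (@ker_pred U).
Proof.
split=> [|a s t]; first by rewrite unfold_in /ker_pred linear0.
rewrite !unfold_in /ker_pred => /eqP fs /eqP ft.
by rewrite happ_linear fs ft scaler0 addr0.
Qed.

HB.instance Definition _ U := GRing.isSubmodClosed.Build (O U) (M U)
  (@ker_pred U) (GRing.submod_closed_semi (@ker_submod U)).

Record ker_sec (U : opens X) := KerSec {
  ker_val :> M U;
  ker_valP : ker_val \in @ker_pred U }.

HB.instance Definition _ U := [isSub for @ker_val U].
HB.instance Definition _ U := [Choice of ker_sec U by <:].
HB.instance Definition _ U := [SubChoice_isSubLmodule of ker_sec U by <:].

End Kernel.

(* Exactness in the category of sheaves: being in the image is a local condition. *)
Record short_exact (M' M M'' : mod_sheaf) (i : mod_hom M' M)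
    (p : mod_hom M M'') : Prop := ShortExact {
  se_inj : forall U (s : M' U), i U s = 0 -> s = 0;
  se_exact : forall U (s : M U), p U s = 0 <->
    forall x, carrier U x -> exists (V : opens X) (VU : V `<=` U) (t : M' V),
      carrier V x /\ i V t = mres VU s;
  se_surj : forall U (s : M'' U) x, carrier U x ->
    exists (V : opens X) (VU : V `<=` U) (t : M V),
      carrier V x /\ p V t = mres VU s }.

End Modules.

Lemma sheaf_eq (X : topologicalType) (F : opens X -> Type)
    (res : forall U V : opens X, V `<=` U -> F U -> F V) :
  is_sheaf res -> (forall (U V W : opens X) (VU : V `<=` U) (WV : W `<=` V)
    (WU : W `<=` U) s, res _ _ WV (res _ _ VU s) = res _ _ WU s) ->
  forall (U : opens X) (I : Type) (V : I -> opens X)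
    (VU : forall i, V i `<=` U), U `<=` \bigcup_i V i ->
  forall s t : F U, (forall i, res _ _ (VU i) s = res _ _ (VU i) t) -> s = t.
Proof.
move=> shF resc U I V VU cov s t st.
have [|r [_ ru]] := shF U I V VU cov (fun i => res _ _ (VU i) s).
  by move=> i j W Wi Wj; rewrite !(resc _ _ _ _ _ (subset_trans Wi (VU i))).
by rewrite -(ru s) // -(ru t).
Qed.

Section KernelSheaf.
Variables (X : topologicalType) (O : ring_sheaf X) (M N : mod_sheaf O).
Variable f : mod_hom M N.

Lemma ker_res_proof (U V : opens X) (VU : V `<=` U) (s : ker_sec f U) :
  mres VU (ker_val s) \in @ker_pred _ _ _ _ f V.
Proof.
case: s => s /=; rewrite !unfold_in /ker_pred => /eqP fs.
by rewrite happ_res fs mres0.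
Qed.

Definition ker_res (U V : opens X) (VU : V `<=` U) (s : ker_sec f U) : ker_sec f V :=
  KerSec (ker_res_proof VU s).

Lemma ker_resD (U V : opens X) (VU : V `<=` U) (s t : ker_sec f U) :
  ker_res VU (s + t) = ker_res VU s + ker_res VU t.
Proof. by apply: val_inj; rewrite /= mresD. Qed.

Lemma ker_resZ (U V : opens X) (VU : V `<=` U) (a : O U) (s : ker_sec f U) :
  ker_res VU (a *: s) = rres O VU a *: ker_res VU s.
Proof. by apply: val_inj; rewrite /= mresZ. Qed.

Lemma ker_res_id (U : opens X) (UU : U `<=` U) s : ker_res UU s = s.
Proof. by apply: val_inj; rewrite /= mres_id. Qed.

Lemma ker_res_comp (U V W : opens X) (VU : V `<=` U) (WV : W `<=` V)
  (WU : W `<=` U) s : ker_res WV (ker_res VU s) = ker_res WU s.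
Proof. by apply: val_inj => /=; exact: mres_comp. Qed.

Lemma ker_sheaf : is_sheaf ker_res.
Proof.
move=> U I V VU cov s sc.
have [|t [ts tu]] := @msec_sheaf _ _ M U I V VU cov (fun i => ker_val (s i)).
  by move=> i j W Wi Wj; have /(congr1 (@ker_val _ _ _ _ _ _)) := sc i j W Wi Wj.
have kt : t \in @ker_pred _ _ _ _ f U.
  rewrite unfold_in /ker_pred; apply/eqP.
  apply: (sheaf_eq (@msec_sheaf _ _ N) (@mres_comp _ _ N) cov) => i.
  rewrite -happ_res ts mres0; apply/eqP; exact: (ker_valP (s i)).
exists (KerSec kt); split=> [i|u us]; first by apply: val_inj; exact: ts.
by apply: val_inj; apply: tu => i; rewrite -(us i).
Qed.

Definition mod_kernel : mod_sheaf O :=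
  ModSheaf ker_resD ker_resZ ker_res_id ker_res_comp ker_sheaf.

Definition kernel_incl : mod_hom mod_kernel M :=
  @ModHom _ _ mod_kernel M (fun U s => ker_val s) (fun U a s t => erefl)
    (fun U V VU s => erefl).

Lemma kernelP : is_kernel (C := mod_cat O) f kernel_incl.
Proof.
split.
  apply: mod_hom_eq => U s; apply/eqP; exact: (ker_valP s).
move=> T t ft.
have kt U s : t U s \in @ker_pred _ _ _ _ f U.
  rewrite unfold_in /ker_pred; apply/eqP.
  by have := congr1 (fun h : mod_hom T N => h U s) ft.
have hl U : linear (fun s : T U => KerSec (kt U s) : mod_kernel U).
  by move=> a s s'; apply: val_inj; rewrite /= happ_linear.
have hr (U V : opens X) (VU : V `<=` U) (s : T U) :
    KerSec (kt V (mres VU s)) = mres VU (KerSec (kt U s) : mod_kernel U).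
  by apply: val_inj; rewrite /= happ_res.
exists (@ModHom _ _ T mod_kernel (fun U s => KerSec (kt U s)) hl hr); split; first exact: mod_hom_eq.
move=> h' h't; apply: mod_hom_eq => U s; apply: val_inj => /=.
by rewrite -h't.
Qed.

End KernelSheaf.

Section Restriction.
Variables (X : topologicalType) (U : opens X).

Lemma open_push (V : set (set_type U)) : open V -> open (set_val @` V).
Proof.
move=> [W oW <-]; have -> : set_val @` (set_val @^-1` W : set (set_type U)) = W `&` U.
  apply/seteqP; split=> [_ [x Wx <-]|x [Wx Ux]]; first by split=> //; exact: set_valP.
  by exists (SigSub (mem_set Ux)).
by apply: openI => //; exact: carrier_open.
Qed.

(* [set_type U] carries the subspace topology; its open subsets are open in X *)
Definition push (V : opens (set_type U)) : opens X :=
  Opens (open_push (carrier_open V)).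

Lemma push_sub (V W : opens (set_type U)) : W `<=` V -> push W `<=` push V.
Proof. exact: image_subset. Qed.

Lemma sub_push (V W : opens (set_type U)) : push W `<=` push V -> W `<=` V.
Proof.
move=> WV x Wx; have [|y Vy yx] := WV (set_val x); first by exists x.
by rewrite -(val_inj yx).
Qed.

Lemma push_onto (V : opens X) : V `<=` U -> exists W, V = push W.
Proof.
move=> VU; have oW : open (set_val @^-1` V : set (set_type U)).
  by exists V => //; exact: carrier_open.
exists (Opens oW); apply: opens_eq; apply/seteqP; split=> [x Vx|_ [x Vx <-] //].
by exists (SigSub (mem_set (VU x Vx))).
Qed.

Lemma restrict_sheaf (F : opens X -> Type)
    (res : forall U V : opens X, V `<=` U -> F U -> F V) :
  is_sheaf res ->
  is_sheaf (fun V W (WV : W `<=` V) => res _ _ (push_sub WV)).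
Proof.
move=> shF V I W WV cov s sc; apply: (shF (push V) I (fun i => push (W i))).
- by move=> _ [x /cov [i _ Wix] <-]; exists i => //; exists x.
- move=> i j Z Zi Zj.
  have [Z' ZZ'] : exists Z', Z = push Z'.
    apply: push_onto => x /Zi [y _ <-]; exact: set_valP.
  subst Z; rewrite (Prop_irrelevance Zi (push_sub (sub_push Zi))).
  rewrite (Prop_irrelevance Zj (push_sub (sub_push Zj))).
  exact: (sc i j Z' (sub_push Zi) (sub_push Zj)).
Qed.

Variable O : ring_sheaf X.

Definition ring_restrict : ring_sheaf (set_type U) :=
  @RingSheaf (set_type U) (fun V => O (push V))
    (fun V W WV => rres O (push_sub WV))
    (fun V VV => @rres_id _ O _ (push_sub VV))
    (fun V W Z WV ZW ZV => @rres_comp _ O _ _ _ (push_sub WV) (push_sub ZW) (push_sub ZV))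
    (restrict_sheaf (@rsec_sheaf _ O)).

Definition mod_restrict (M : mod_sheaf O) : mod_sheaf ring_restrict :=
  @ModSheaf (set_type U) ring_restrict (fun V => M (push V))
    (fun V W WV => @mres _ _ M _ _ (push_sub WV))
    (fun V W WV => @mresD _ _ M _ _ (push_sub WV))
    (fun V W WV => @mresZ _ _ M _ _ (push_sub WV))
    (fun V VV => @mres_id _ _ M _ (push_sub VV))
    (fun V W Z WV ZW ZV => @mres_comp _ _ M _ _ _ (push_sub WV) (push_sub ZW) (push_sub ZV))
    (restrict_sheaf (@msec_sheaf _ _ M)).

End Restriction.

Section Free.
Variables (X : topologicalType) (O : ring_sheaf X) (I : Type).

Definition loc_finite (U : opens X) (s : I -> (O U)^o) : Prop :=
  forall x, carrier U x -> exists (V : opens X) (VU : V `<=` U),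
    carrier V x /\ finite_set [set i | rres O VU (s i) <> 0].

Definition free_pred (U : opens X) : {pred I -> (O U)^o} :=
  fun s => `[< loc_finite s >].

Lemma free_submod U : submod_closed (@free_pred U).
Proof.
split=> [|a s t].
  apply/asboolP => x Ux; exists U, (@subset_refl _ U); split=> //.
  rewrite (_ : [set _ | _] = set0) //; apply/seteqP; split=> // i /=.
  by rewrite rmorph0.
move=> /asboolP sf /asboolP tf; apply/asboolP => x Ux.
have [V [VU [Vx fV]]] := sf x Ux; have [W [WU [Wx fW]]] := tf x Ux.
have oVW : open (V `&` W) by apply: openI; exact: carrier_open.
pose Z := Opens oVW.
have ZV : Z `<=` V by move=> ? [].
have ZW : Z `<=` W by move=> ? [].
exists Z, (subset_trans ZV VU); split=> //.
apply: (@sub_finite_set _ _ ([set i | rres O VU (s i) <> 0] `|`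
  [set i | rres O WU (t i) <> 0])); last by rewrite finite_setU.
move=> i /= ne; apply: contrapT => /not_orP [/contrapT s0 /contrapT t0].
apply: ne; rewrite -[(a *: s + t) i]/(a * s i + t i) rmorphD rmorphM.
rewrite -(rres_comp VU ZV (subset_trans ZV VU) (s i)) s0 rmorph0 mulr0 add0r.
by rewrite -(rres_comp WU ZW (subset_trans ZV VU) (t i)) t0 rmorph0.
Qed.

HB.instance Definition _ U := GRing.isSubmodClosed.Build (O U) (I -> (O U)^o)
  (@free_pred U) (GRing.submod_closed_semi (@free_submod U)).

(* The direct sum of copies of O indexed by I is the subsheaf of the product
   O^I of the families that are locally of finite support (the sheafification
   of U |-> O(U)^(I)). *)
Record free_sec (U : opens X) := FreeSec {
  free_val :> I -> (O U)^o;
  free_valP : free_val \in @free_pred U }.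

HB.instance Definition _ U := [isSub for @free_val U].
HB.instance Definition _ U := [Choice of free_sec U by <:].
HB.instance Definition _ U := [SubChoice_isSubLmodule of free_sec U by <:].

Lemma free_res_proof (U V : opens X) (VU : V `<=` U) (s : free_sec U) :
  (fun i => rres O VU (s i) : (O V)^o) \in @free_pred V.
Proof.
have /asboolP sf := free_valP s; apply/asboolP => x Vx.
have [W [WU [Wx fW]]] := sf x (VU x Vx).
have oVW : open (V `&` W) by apply: openI; exact: carrier_open.
pose Z := Opens oVW.
have ZV : Z `<=` V by move=> ? [].
have ZW : Z `<=` W by move=> ? [].
exists Z, ZV; split=> //; apply: sub_finite_set fW => i /= ne si0; apply: ne.
rewrite (rres_comp VU ZV (subset_trans ZV VU)).
by rewrite -(rres_comp WU ZW (subset_trans ZV VU)) si0 rmorph0.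
Qed.

Definition free_res (U V : opens X) (VU : V `<=` U) (s : free_sec U) : free_sec V :=
  FreeSec (free_res_proof VU s).

Lemma free_resD (U V : opens X) (VU : V `<=` U) (s t : free_sec U) :
  free_res VU (s + t) = free_res VU s + free_res VU t.
Proof. by apply: val_inj; apply/funext => i; exact: rmorphD. Qed.

Lemma free_resZ (U V : opens X) (VU : V `<=` U) (a : O U) (s : free_sec U) :
  free_res VU (a *: s) = rres O VU a *: free_res VU s.
Proof. by apply: val_inj; apply/funext => i; exact: rmorphM. Qed.

Lemma free_res_id (U : opens X) (UU : U `<=` U) s : free_res UU s = s.
Proof. by apply: val_inj; apply/funext => i; exact: rres_id. Qed.

Lemma free_res_comp (U V W : opens X) (VU : V `<=` U) (WV : W `<=` V)
  (WU : W `<=` U) s : free_res WV (free_res VU s) = free_res WU s.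
Proof. by apply: val_inj; apply/funext => i; exact: rres_comp. Qed.

Lemma free_sheaf : is_sheaf free_res.
Proof.
move=> U J V VU cov s sc.
have glue i : exists! t : O U, forall j, rres O (VU j) t = s j i.
  apply: (@rsec_sheaf _ O U J V VU cov (fun j => s j i)) => j k W Wj Wk.
  by have /(congr1 (fun r : free_sec W => free_val r i)) := sc j k W Wj Wk.
have [t tP] := choice glue.
have ft : (t : I -> (O U)^o) \in @free_pred U.
  apply/asboolP => x Ux; have [j _ Vjx] := cov x Ux.
  have /asboolP /(_ x Vjx) [W [WV [Wx fW]]] := free_valP (s j).
  exists W, (subset_trans WV (VU j)); split=> //.
  apply: sub_finite_set fW => i /= ne si0; apply: ne.
  by rewrite -(rres_comp (VU j) WV) (proj1 (tP i)).
exists (FreeSec ft); split=> [j|u us].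
  by apply: val_inj; apply/funext => i; exact: (proj1 (tP i)).
apply: val_inj; apply/funext => i; apply: (proj2 (tP i)) => j.
by rewrite -(us j).
Qed.

Definition free_mod : mod_sheaf O :=
  ModSheaf free_resD free_resZ free_res_id free_res_comp free_sheaf.

End Free.

Definition quasi_coherent (X : topologicalType) (O : ring_sheaf X)
    (M : mod_sheaf O) : Prop :=
  forall x : X, exists U : opens X, carrier U x /\
    exists (I J : Type)
      (f : mod_hom (free_mod (ring_restrict U O) J) (free_mod (ring_restrict U O) I))
      (c : mod_hom (free_mod (ring_restrict U O) I) (mod_restrict U M)),
      is_cokernel (C := mod_cat (ring_restrict U O)) f c.

Section FiniteSpace.
Variables (X : topologicalType) (finX : finite_set [set: X]).

Lemma open_min (p : X) : open (\bigcap_(W in [set W | open W /\ W p]) W).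
Proof.
rewrite -closedC; set U := \bigcap_(W in _) W.
have /choice [W WP] (y : X) :
    exists W : set X, [/\ open W, W p & ~ U y -> ~ W y].
  have [Uy|/existsNP [W /not_implyP [[oW Wp] Wy]]] := pselect (U y).
    by exists setT; split=> //; exact: openT.
  by exists W.
rewrite (_ : ~` U = \bigcup_(y in ~` U) ~` W y).
  apply: closed_bigcup; first by apply: sub_finite_set finX.
  by move=> y _; apply: open_closedC; case: (WP y).
apply/seteqP; split=> [y Uy|y [z _ Wzy] Uy]; first by exists y => //; case: (WP y) => _ _; exact.
by apply: Wzy; case: (WP z) => oW Wp _; exact: Uy.
Qed.

(* U_p *)
Definition min_open (p : X) : opens X := Opens (open_min p).

Lemma min_open_sub (p q : X) : carrier (min_open p) q -> min_open q `<=` min_open p.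
Proof. by move=> pq x qx W [oW Wp]; apply: qx; split=> //; exact: pq. Qed.

(* p <= q *)
Definition spec_le (p q : X) : Prop := carrier (min_open p) q.

Variable O : ring_sheaf X.

Definition stalk (p : X) : comPzRingType := O (min_open p).

Definition stalk_res (p q : X) (pq : spec_le p q) : {rmorphism stalk p -> stalk q} :=
  rres O (min_open_sub pq).

Definition finite_space : Prop :=
  forall (p q : X) (pq : spec_le p q), is_flat (stalk_res pq).

End FiniteSpace.

(* Main.v *)
(* On a finite space a sheaf is determined by its sections over the minimal open
   sets U_p, and exactness can be tested there. A module M is quasi-coherent iff
   M(U_p) (x) O(U_q) -> M(U_q) is bijective for all p <= q: a presentation over a
   neighbourhood of p gives this by right exactness of the tensor product, and
   conversely a presentation of the O(U_p)-module M(U_p) becomes one of M over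
   U_p. Since O(U_p) -> O(U_q) is flat, a five-lemma chase shows that this base
   change condition passes to kernels, cokernels and extensions. *)
Require Import Defs.
From HB Require Import structures.
From mathcomp Require Import all_boot all_order all_algebra.
From mathcomp Require Import all_classical.
From mathcomp Require Import topology.

Set Implicit Arguments.
Unset Strict Implicit.
Unset Printing Implicit Defensive.

Import GRing.Theory.
Local Open Scope classical_set_scope.
Local Open Scope quotient_scope.
Local Open Scope ring_scope.

(** * Tensor products and base change *)

(** The presentation in [quasi_coherent] lives on the subspace [set_type U], whose minimal open sets
    are not literally the [min_open p] of [X]. The argument therefore speaks of cells, open sets
    that are the least neighbourhood of some point, a notion that [push] preserves and reflects. A
    cell covered by open sets lies in a single one of them, so on cells local conditions become
    global: local preimages are preimages, locally finite families are finite, and the sections of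
    the cokernel sheaf are the quotient module. Flatness is also used in passing from base change to
    a presentation: the kernel of the map from the free module on the sections over U_p must itself
    satisfy base change in order to be generated by its own sections over U_p. *)

Section TensorFacts.
Variables (A : comPzRingType) (M N : lmodType A).

Lemma tensor_ind (P : tensor M N -> Prop) :
    P 0 -> (forall m n x, P x -> P (tpure m n + x)) -> forall x, P x.
Proof.
move=> P0 Padd x; rewrite -(treprK x); elim: (trepr x) => [|[m n] s IH] //.
by rewrite -cat1s -taddE; exact: Padd.
Qed.

Lemma tpureDl (m m' : M) (n : N) : tpure (m + m') n = tpure m n + tpure m' n.
Proof. by rewrite [RHS]taddE; apply/tclassP; exact: trel_addl. Qed.

Lemma tpureDr (m : M) (n n' : N) : tpure m (n + n') = tpure m n + tpure m n'.
Proof. by rewrite [RHS]taddE; apply/tclassP; exact: trel_addr. Qed.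

Lemma tpureZ a (m : M) (n : N) : tpure (a *: m) n = tpure m (a *: n).
Proof. by apply/tclassP; exact: trel_scale. Qed.

Lemma tpure0l (n : N) : tpure (0 : M) n = 0.
Proof. by apply/tclassP; exact: trel_zero. Qed.

Lemma tpure0r (m : M) : tpure m (0 : N) = 0.
Proof. by apply: (addrI (tpure m 0)); rewrite -tpureDr !addr0. Qed.

Lemma tpure_suml (I : Type) (r : seq I) (F : I -> M) (n : N) :
  tpure (\sum_(i <- r) F i) n = \sum_(i <- r) tpure (F i) n.
Proof.
elim: r => [|i r IH]; first by rewrite !big_nil tpure0l.
by rewrite !big_cons tpureDl IH.
Qed.

End TensorFacts.

Section BaseChange.
Variables (A B : comPzRingType) (phi : {rmorphism A -> B}).
Local Notation B_A := (restrict_scalars phi).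

(** Restriction maps of a module sheaf join modules over two different rings; semilinearity lets the
    target keep its own [B]-module structure. *)
Definition semilinear_along (M : lmodType A) (N : lmodType B) (r : M -> N) : Prop :=
  (forall x y, r (x + y) = r x + r y) /\ (forall a x, r (a *: x) = phi a *: r x).

Section Extension.
Variables (M : lmodType A) (N : lmodType B) (r : M -> N).

(* The map [M (x)_A B -> N] that sends [m (x) b] to [b *: r m]. *)
Definition scalar_ext (x : tensor M B_A) : N :=
  \sum_(mb <- trepr x) (mb.2 : B) *: r mb.1.

Definition base_change : Prop :=
  (forall n, exists x, scalar_ext x = n) /\ (forall x, scalar_ext x = 0 -> x = 0).

Hypothesis r_semi : semilinear_along r.

Lemma semilinear0 : r 0 = 0.
Proof. by apply: (addrI (r 0)); rewrite -(proj1 r_semi) !addr0. Qed.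

Lemma semilinear_sum (I : Type) (s : seq I) (F : I -> M) :
  r (\sum_(i <- s) F i) = \sum_(i <- s) r (F i).
Proof.
elim: s => [|i s IH]; first by rewrite !big_nil semilinear0.
by rewrite !big_cons (proj1 r_semi) IH.
Qed.

(** The definition of [scalar_ext] uses a chosen representative; the sum respects every generator of
    [tensor_rel], so any representative computes it. *)
Lemma scalar_extE (s : seq (M * B_A)) :
  scalar_ext (tclass s) = \sum_(mb <- s) (mb.2 : B) *: r mb.1.
Proof.
suff E (u v : seq (M * B_A)) : tensor_rel u v ->
    \sum_(mb <- u) (mb.2 : B) *: r mb.1 = \sum_(mb <- v) (mb.2 : B) *: r mb.1.
  by apply: E; exact: trepr_class.
have [rD rZ] := r_semi; elim=> {u v} //=.
- by move=> u v w _ -> _ ->.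
- by move=> u u' v v' _ + _; rewrite !big_cat /= => -> ->.
- by move=> u v; rewrite !big_cat /= addrC.
- by move=> m m' n; rewrite !big_cons !big_nil /= rD scalerDr !addr0.
- by move=> m n n'; rewrite !big_cons !big_nil /= scalerDl !addr0.
- by move=> a m n; rewrite !big_cons !big_nil /= rZ scalerA mulrC.
- by move=> n; rewrite !big_cons !big_nil /= semilinear0 scaler0 addr0.
Qed.

Lemma scalar_ext0 : scalar_ext 0 = 0.
Proof. by rewrite [X in scalar_ext X]/0 /= scalar_extE big_nil. Qed.

Lemma scalar_extD x y : scalar_ext (x + y) = scalar_ext x + scalar_ext y.
Proof.
rewrite -(treprK x) -(treprK y) [X in scalar_ext X]taddE !scalar_extE.
by rewrite big_cat.
Qed.

Lemma scalar_ext_pure m (b : B_A) : scalar_ext (tpure m b) = (b : B) *: r m.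
Proof. by rewrite scalar_extE big_cons big_nil addr0. Qed.

Lemma scalar_ext_sum (I : Type) (s : seq I) (F : I -> tensor M B_A) :
  scalar_ext (\sum_(i <- s) F i) = \sum_(i <- s) scalar_ext (F i).
Proof.
elim: s => [|i s IH]; first by rewrite !big_nil scalar_ext0.
by rewrite !big_cons scalar_extD IH.
Qed.

Lemma scalar_extB x y : scalar_ext (x - y) = scalar_ext x - scalar_ext y.
Proof. by apply/eqP; rewrite eq_sym subr_eq -scalar_extD subrK. Qed.

End Extension.

Lemma scalar_ext_natural (M1 M2 : lmodType A) (N1 N2 : lmodType B)
    (r1 : M1 -> N1) (r2 : M2 -> N2) (f : {linear M1 -> M2}) (g : {linear N1 -> N2}) :
    semilinear_along r1 -> semilinear_along r2 -> (forall m, g (r1 m) = r2 (f m)) ->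
  forall x, scalar_ext r2 (tensor_map f x) = g (scalar_ext r1 x).
Proof.
move=> s1 s2 gr; elim/tensor_ind => [|m b x IH].
  by rewrite raddf0 !scalar_ext0 ?raddf0.
rewrite raddfD /= tensor_map_pure !scalar_extD // !scalar_ext_pure // IH.
by rewrite raddfD /= linearZ /= gr.
Qed.

Section ThreeTerms.
Variables (M1 M2 M3 : lmodType A) (N1 N2 N3 : lmodType B).
Variables (r1 : M1 -> N1) (r2 : M2 -> N2) (r3 : M3 -> N3).
Variables (f : {linear M1 -> M2}) (g : {linear M2 -> M3}).
Variables (f' : {linear N1 -> N2}) (g' : {linear N2 -> N3}).
Hypotheses (s1 : semilinear_along r1) (s2 : semilinear_along r2).
Hypothesis s3 : semilinear_along r3.
Hypotheses (fr : forall m, f' (r1 m) = r2 (f m)).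
Hypotheses (gr : forall m, g' (r2 m) = r3 (g m)).
Hypothesis flat : is_flat phi.
Hypothesis ex : forall y, g y = 0 <-> exists x, f x = y.
Hypothesis ex' : forall y, g' y = 0 <-> exists x, f' x = y.

(** [is_flat] speaks of exactness in the middle; injectivity of [h] is exactness of the zero map of
    [M1] followed by [h], and tensoring the zero map gives zero. *)
Lemma flat_inj (h : {linear M1 -> M2}) :
  injective h -> injective (tensor_map h (N := B_A)).
Proof.
move=> hI x y /eqP; rewrite -subr_eq0 -raddfB => /eqP hxy.
have /= := flat (f := \0 : {linear M1 -> M1}) (g := h) _ (x - y).
case=> [z|/(_ hxy) [z zxy] _]; last first.
  apply/eqP; rewrite -subr_eq0 -zxy; apply/eqP.
  elim/tensor_ind: z {zxy} => [|m b z IH]; first by rewrite raddf0.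
  by rewrite raddfD /= IH addr0 tensor_map_pure /= tpure0l.
split=> [hz|[u <-]]; last by rewrite linear0.
by exists 0; apply: hI; rewrite /= hz linear0.
Qed.

(** Chase for the left term. A lift [y] of [f' n] dies in the third tensor product because the third
    comparison is injective, so by flatness it comes from the first; injectivity combines [flat_inj]
    with that of the middle comparison. *)
Lemma base_change_kernel : injective f -> injective f' ->
  base_change r2 -> base_change r3 -> base_change r1.
Proof.
move=> fI f'I [surj2 inj2] [_ inj3]; split=> [n|x x0].
  have [y yn] := surj2 (f' n).
  have gy : tensor_map g y = 0.
    apply: inj3; rewrite (scalar_ext_natural s2 s3 gr) yn.
    by apply/ex'; exists n.
  have [x xy] := (flat ex y).1 gy; exists x; apply: f'I.
  by rewrite -(scalar_ext_natural s1 s2 fr) xy.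
apply: (flat_inj fI); rewrite raddf0; apply: inj2.
by rewrite (scalar_ext_natural s1 s2 fr) x0 raddf0.
Qed.

Lemma tensor_map_surj : (forall y, exists x, g x = y) ->
  forall z, exists y, tensor_map g y = z :> tensor M3 B_A.
Proof.
move=> gS; elim/tensor_ind => [|m b z [y <-]]; first by exists 0; rewrite raddf0.
by have [x <-] := gS m; exists (tpure x b + y); rewrite raddfD /= tensor_map_pure.
Qed.

(** Chase for the right term. For injectivity, lift [z] to [y]: its image in [N2] comes from [N1],
    hence from a tensor [x] over [M1], and injectivity of the middle comparison identifies [y] with
    the image of [x]. *)
Lemma base_change_cokernel : (forall y, exists x, g x = y) ->
    (forall y, exists x, g' x = y) ->
  base_change r1 -> base_change r2 -> base_change r3.
Proof.
move=> gS g'S [surj1 _] [surj2 inj2]; split=> [n|z z0].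
  have [n2 <-] := g'S n; have [y <-] := surj2 n2.
  by exists (tensor_map g y); rewrite (scalar_ext_natural s2 s3 gr).
have [y yz] := tensor_map_surj gS z; rewrite -yz in z0 *.
rewrite (scalar_ext_natural s2 s3 gr) in z0.
have [n1 n1y] := (ex' _).1 z0; have [x xn1] := surj1 n1.
apply/(flat ex); exists x; apply/eqP; rewrite -subr_eq0; apply/eqP; apply: inj2.
by rewrite scalar_extB // (scalar_ext_natural s1 s2 fr) xn1 n1y subrr.
Qed.

(** Chase for the middle term. A lift of [g' n] is corrected by a tensor coming from [M1]; a tensor
    killed by the comparison comes from [M1] by flatness and vanishes there because [f'] and the
    first comparison are injective. *)
Lemma base_change_middle : injective f' -> (forall y, exists x, g x = y) ->
  base_change r1 -> base_change r3 -> base_change r2.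
Proof.
move=> f'I gS [surj1 inj1] [surj3 inj3]; split=> [n|y y0].
  have [z zn] := surj3 (g' n); have [y yz] := tensor_map_surj gS z.
  have : g' (n - scalar_ext r2 y) = 0.
    by rewrite raddfB /= -(scalar_ext_natural s2 s3 gr) yz zn subrr.
  move=> /ex' [n1 n1E]; have [x xn1] := surj1 n1.
  exists (tensor_map f x + y); rewrite scalar_extD //.
  by rewrite (scalar_ext_natural s1 s2 fr) xn1 n1E subrK.
have [|x xy] := (flat ex y).1.
  by apply: inj3; rewrite (scalar_ext_natural s2 s3 gr) y0 raddf0.
rewrite -xy (inj1 x) ?raddf0 //; apply: f'I.
by rewrite -(scalar_ext_natural s1 s2 fr) xy y0 raddf0.
Qed.

End ThreeTerms.

End BaseChange.

(** * Quotient of a module by the image of a linear map *)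

Section QuotientModule.
Variables (A : comPzRingType) (M N : lmodType A) (f : {linear M -> N}).

Definition lrange : {pred N} := fun y => `[< exists x, f x = y >].

Lemma lrange_submod : submod_closed lrange.
Proof.
split=> [|a _ _ /asboolP [x <-] /asboolP [y <-]]; apply/asboolP.
  by exists 0; rewrite raddf0.
by exists (a *: x + y); rewrite linearP.
Qed.

HB.instance Definition _ := GRing.isSubmodClosed.Build A N lrange
  (GRing.submod_closed_semi lrange_submod).

Definition lquot : Type := Quotient.quot lrange.
HB.instance Definition _ := GRing.Zmodule.on lquot.

Definition lpi (y : N) : lquot := \pi_(Quotient.quot lrange) y.

Lemma lpiD : {morph lpi : x y / x + y}.
Proof. by move=> x y; rewrite /lpi raddfD. Qed.

Lemma lpiB : {morph lpi : x y / x - y}.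
Proof. by move=> x y; rewrite /lpi raddfB. Qed.

Lemma lpi_surj (q : lquot) : exists y, lpi y = q.
Proof. by exists (repr (q : Quotient.quot lrange)); exact: reprK. Qed.

Lemma lpi_eq0 y : lpi y = 0 <-> exists x, f x = y.
Proof.
have l0 : lpi 0 = 0 by rewrite /lpi raddf0.
rewrite -l0; split=> [/eqP|fx].
  by rewrite /lpi -Quotient.idealrBE subr0 => /asboolP.
by apply/eqP; rewrite /lpi -Quotient.idealrBE subr0; apply/asboolP.
Qed.

Lemma lpi_eq y z : lpi y = lpi z <-> exists x, f x = y - z.
Proof.
rewrite -lpi_eq0 lpiB; split=> [->|/eqP]; first by rewrite subrr.
by rewrite subr_eq0 => /eqP.
Qed.

Definition lquot_scale (a : A) (q : lquot) : lquot :=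
  lpi (a *: repr (q : Quotient.quot lrange)).

Lemma lquot_scaleE a y : lquot_scale a (lpi y) = lpi (a *: y).
Proof.
apply/lpi_eq; rewrite -scalerBr.
have /lpi_eq [x xE] : lpi (repr (lpi y : Quotient.quot lrange)) = lpi y.
  exact: reprK.
by exists (a *: x); rewrite linearZ /= xE.
Qed.

Lemma lquot_scaleA a b q : lquot_scale a (lquot_scale b q) = lquot_scale (a * b) q.
Proof. by have [y <-] := lpi_surj q; rewrite !lquot_scaleE scalerA. Qed.
Lemma lquot_scale1 : left_id 1 lquot_scale.
Proof. by move=> q; have [y <-] := lpi_surj q; rewrite lquot_scaleE scale1r. Qed.
Lemma lquot_scaleDr : right_distributive lquot_scale +%R.
Proof.
move=> a q q'; have [y <-] := lpi_surj q; have [y' <-] := lpi_surj q'.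
by rewrite -lpiD !lquot_scaleE scalerDr lpiD.
Qed.
Lemma lquot_scaleDl q : {morph lquot_scale^~ q : a b / a + b}.
Proof.
by move=> a b; have [y <-] := lpi_surj q; rewrite !lquot_scaleE scalerDl lpiD.
Qed.

HB.instance Definition _ := GRing.Zmodule_isLmodule.Build A lquot
  lquot_scaleA lquot_scale1 lquot_scaleDr lquot_scaleDl.

Lemma lpiZ a y : lpi (a *: y) = a *: lpi y.
Proof. by rewrite [RHS]lquot_scaleE. Qed.

End QuotientModule.

(** * Minimal open sets *)

Section Cells.
Variable X : topologicalType.

Definition minimal_at (W : opens X) (x : X) : Prop :=
  carrier W x /\ forall V : opens X, carrier V x -> W `<=` V.

(* For a finite [X] the cells are the sets U_p. *)
Definition cell (W : opens X) : Prop := exists x, minimal_at W x.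

Definition has_cells : Prop := forall x, exists W, minimal_at W x.

Record cell_in (V : opens X) := CellIn {
  cell_of :> opens X;
  cell_ofP : cell cell_of;
  cell_sub : cell_of `<=` V }.

Hypothesis hc : has_cells.

Lemma cell_cover (V : opens X) : V `<=` \bigcup_(W in [set: cell_in V]) W.
Proof.
move=> x Vx; have [W [Wx Wmin]] := hc x.
by exists (CellIn (ex_intro _ x (conj Wx Wmin)) (Wmin V Vx)).
Qed.

Lemma cell_self (W V : opens X) x :
  minimal_at W x -> V `<=` W -> carrier V x -> V = W.
Proof.
move=> [_ Wmin] VW Vx; apply: opens_eq; apply/seteqP; split=> //; exact: Wmin.
Qed.

Section Modules.
Variable O : ring_sheaf X.
Implicit Types M N K : mod_sheaf O.

Lemma mres_comp' M (U V W : opens X) (VU : V `<=` U) (WV : W `<=` V) (s : M U) :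
  mres WV (mres VU s) = mres (subset_trans WV VU) s.
Proof. exact: mres_comp. Qed.

Lemma section_eq M (V : opens X) (s t : M V) :
  (forall (W : opens X) (WV : W `<=` V), cell W -> mres WV s = mres WV t) -> s = t.
Proof.
move=> st; apply: (@sheaf_eq X (fun U => M U) (@mres _ _ M) (@msec_sheaf _ _ M)
  (@mres_comp _ _ M) V (cell_in V) (@cell_of V) (@cell_sub V) (@cell_cover V)) => W.
by apply: st; exact: cell_ofP.
Qed.

Lemma hom_eq_cells M N (f g : mod_hom M N) :
  (forall W, cell W -> forall s, f W s = g W s) -> f = g.
Proof.
move=> fg; apply: mod_hom_eq => V s; apply: section_eq => W WV cW.
by rewrite -!happ_res fg.
Qed.

(** [R] is the graph of a morphism known only on cells. A graph is used because the values below
    depend on a choice, of a preimage or of a finite support, which functionality of [R] makes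
    harmless. *)
Lemma hom_of_rel M N (R : forall W : opens X, M W -> N W -> Prop) :
    (forall W s, cell W -> exists t, R W s t) ->
    (forall W s t t', cell W -> R W s t -> R W s t' -> t = t') ->
    (forall W a s s' t t', cell W ->
      R W s t -> R W s' t' -> R W (a *: s + s') (a *: t + t')) ->
    (forall (V W : opens X) (WV : W `<=` V) s t, cell V -> cell W ->
      R V s t -> R W (mres WV s) (mres WV t)) ->
  exists g : mod_hom M N, forall W s, cell W -> R W s (g W s).
Proof.
move=> Rtot Rfun Rlin Rres.
(* The graph over an arbitrary open set is tested on the cells inside it: uniqueness is then
   [section_eq], and existence is gluing. *)
pose R' V (s : M V) (t : N V) :=
  forall (W : opens X) (WV : W `<=` V), cell W -> R W (mres WV s) (mres WV t).
have R'fun V s t t' : R' V s t -> R' V s t' -> t = t'.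
  move=> st st'; apply: section_eq => W WV cW.
  exact: (Rfun W (mres WV s)) (st W WV cW) (st' W WV cW).
have R'tot V s : exists t, R' V s t.
  pose t (W : cell_in V) := sval (cid (Rtot W (mres (@cell_sub V W) s) (cell_ofP W))).
  have tP (W : cell_in V) : R W (mres (@cell_sub V W) s) (t W) by rewrite /t; case: cid.
  have [|u [uP _]] := @msec_sheaf _ _ N V _ _ (@cell_sub V) (@cell_cover V) t.
    (* An overlap [W] need not be a cell, so agreement is checked on the cells [Z] inside it, where
       [Rfun] applies. *)
    move=> i j W Wi Wj; apply: section_eq => Z ZW cZ.
    have := Rres _ _ (subset_trans ZW Wi) _ _ (cell_ofP i) cZ (tP i).
    have := Rres _ _ (subset_trans ZW Wj) _ _ (cell_ofP j) cZ (tP j).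
    rewrite !mres_comp' !(Prop_irrelevance (subset_trans _ _)
      (subset_trans ZW (subset_trans Wi (@cell_sub V i)))).
    by move=> Rj Ri; apply: Rfun cZ Ri Rj.
  exists u => W WV cW; by have := tP (CellIn cW WV); rewrite -uP.
pose g V s := sval (cid (R'tot V s)).
have gP V s : R' V s (g V s) by rewrite /g; case: cid.
have gl V : linear (g V).
  move=> a s t; apply: R'fun (gP _ _) _ => W WV cW.
  by rewrite !mresD !mresZ; apply: Rlin => //; exact: gP.
have gr (U V : opens X) (VU : V `<=` U) s : g V (mres VU s) = mres VU (g U s).
  apply: R'fun (gP _ _) _ => W WV cW; rewrite !mres_comp'; exact: gP.
exists (ModHom gl gr) => W s cW /=; have := gP W s W (@subset_refl _ W) cW.
by rewrite !mres_id.
Qed.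

Definition cell_inj M N (f : mod_hom M N) : Prop :=
  forall W, cell W -> injective (f W).

Definition cell_surj M N (f : mod_hom M N) : Prop :=
  forall W, cell W -> forall y, exists x, f W x = y.

Definition cell_exact M N K (f : mod_hom M N) (g : mod_hom N K) : Prop :=
  forall W, cell W -> forall y, g W y = 0 <-> exists x, f W x = y.

Lemma cell_injP M N (f : mod_hom M N) :
  (forall W, cell W -> forall s, f W s = 0 -> s = 0) -> cell_inj f.
Proof.
move=> f0 W cW s t /eqP; rewrite -subr_eq0 -raddfB => /eqP /f0 st0.
by apply/eqP; rewrite -subr_eq0 st0.
Qed.

(** The factorization sends [c y] to [t y]; two preimages differ by an element of the image of [f],
    which [t] kills. *)
Lemma cell_cokernel M N K (f : mod_hom M N) (c : mod_hom N K) :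
  cell_exact f c -> cell_surj c -> is_cokernel (C := mod_cat O) f c.
Proof.
move=> ex surj; split=> [|T t tf].
  by apply: hom_eq_cells => W cW s; apply/(ex W cW); exists s.
have tf0 W s : t W (f W s) = 0 := congr1 (fun h : mod_hom M T => h W s) tf.
have [||||h hP] := @hom_of_rel K T (fun W k u => exists2 y, c W y = k & t W y = u).
- by move=> W s /surj /(_ s) [y ys]; exists (t W y), y.
- move=> W s _ _ cW [y ys <-] [y' ys' <-].
  have /(ex _ cW) [x fx] : c W (y - y') = 0 by rewrite raddfB /= ys ys' subrr.
  by apply/eqP; rewrite -subr_eq0 -raddfB /= -fx tf0.
- move=> W a _ _ _ _ cW [y <- <-] [y' <- <-].
  by exists (a *: y + y'); rewrite linearP.
- by move=> V W WV _ _ cV cW [y <- <-]; exists (mres WV y); rewrite happ_res.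
exists h; split=> [|h' h't].
  apply: hom_eq_cells => W cW s /=; rewrite /comp_app.
  have [y ys <-] := hP W (c W s) cW.
  have /(ex _ cW) [x fx] : c W (s - y) = 0 by rewrite raddfB /= ys subrr.
  by apply/eqP; rewrite eq_sym -subr_eq0 -raddfB /= -fx tf0.
apply: hom_eq_cells => W cW k; have [y yk <-] := hP W k cW.
by rewrite -yk -h't.
Qed.

Lemma cell_kernel M N K (k : mod_hom K M) (f : mod_hom M N) :
  cell_inj k -> cell_exact k f -> is_kernel (C := mod_cat O) f k.
Proof.
move=> inj ex; split=> [|T t ft].
  by apply: hom_eq_cells => W cW s; apply/(ex W cW); exists s.
have ft0 W s : f W (t W s) = 0 := congr1 (fun h : mod_hom T N => h W s) ft.
have [||||h hP] := @hom_of_rel T K (fun W s x => k W x = t W s).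
- by move=> W s cW; apply/(ex W cW).
- by move=> W s x x' cW <- /(inj W cW).
- by move=> W a s s' x x' cW /= xs xs'; rewrite !linearP /= xs xs'.
- by move=> V W WV s x cV cW /= xs; rewrite !happ_res xs.
exists h; split=> [|h' h't]; first by apply: hom_eq_cells => W cW s; exact: hP.
apply: hom_eq_cells => W cW s; apply: (inj W cW).
by rewrite hP // -h't.
Qed.

Lemma kernel_incl_cells M N (f : mod_hom M N) :
  cell_inj (kernel_incl f) /\ cell_exact (kernel_incl f) f.
Proof.
split=> [W _ s t /val_inj //|W _ y]; split=> [/eqP fy|[x <-]].
  by exists (KerSec (f := f) (U := W) fy).
exact/eqP/(ker_valP x).
Qed.

(** The open set [V] on which a preimage exists near the point of a cell is the whole cell by
    [cell_self]. *)
Lemma short_exact_cells M' M M'' (i : mod_hom M' M) (p : mod_hom M M'') :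
  short_exact i p -> [/\ cell_inj i, cell_exact i p & cell_surj p].
Proof.
move=> [inj ex surj]; split.
- by apply: cell_injP => W _; exact: inj.
- move=> W [x mW] s; split=> [/ex /(_ x (proj1 mW)) [V [VW [t [Vx it]]]]|[t <-]].
    have e := cell_self mW VW Vx; subst V.
    by exists t; rewrite it mres_id.
  by apply/ex => y Wy; exists W, (@subset_refl _ W), t; rewrite mres_id.
- move=> W [x mW] s; have [V [VW [t [Vx pt]]]] := surj W s x (proj1 mW).
  have e := cell_self mW VW Vx; subst V.
  by exists t; rewrite pt mres_id.
Qed.

End Modules.
End Cells.

(** * Cokernels *)

Section CokernelSheaf.
Variables (X : topologicalType) (O : ring_sheaf X) (M N : mod_sheaf O).
Variable f : mod_hom M N.

Local Notation Q W := (lquot (f W)).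
Local Notation pi W := (lpi (f W)).

Definition coker_pres (V W : opens X) (WV : W `<=` V) (q : Q V) : Q W :=
  pi W (mres WV (sval (cid (lpi_surj q)))).

Lemma coker_presE (V W : opens X) (WV : W `<=` V) y :
  coker_pres WV (pi V y) = pi W (mres WV y).
Proof.
rewrite /coker_pres; case: cid => z /= /lpi_eq [x xE]; apply/lpi_eq.
exists (mres WV x); rewrite /= happ_res xE mresD; congr (_ + _).
by apply: (addrI (mres WV y)); rewrite -mresD !subrr mres0.
Qed.

Lemma coker_presD (V W : opens X) (WV : W `<=` V) q q' :
  coker_pres WV (q + q') = coker_pres WV q + coker_pres WV q'.
Proof.
have [y <-] := lpi_surj q; have [y' <-] := lpi_surj q'.
by rewrite -lpiD !coker_presE mresD lpiD.
Qed.

Lemma coker_presZ (V W : opens X) (WV : W `<=` V) a q :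
  coker_pres WV (a *: q) = rres O WV a *: coker_pres WV q.
Proof.
have [y <-] := lpi_surj q.
by rewrite -lpiZ !coker_presE mresZ lpiZ.
Qed.

Lemma coker_pres0 (V W : opens X) (WV : W `<=` V) : coker_pres WV 0 = 0.
Proof. by apply: (addrI (coker_pres WV 0)); rewrite -coker_presD !addr0. Qed.

(* Sheafification of the presheaf cokernel: the limit over the cells in V. *)
Record coker_sec (V : opens X) := CokerSec {
  coker_val : forall W : cell_in V, Q W;
  coker_valP : forall (W W' : cell_in V) (h : W' `<=` W),
    coker_pres h (coker_val W) = coker_val W' }.

Lemma coker_sec_eq (V : opens X) (s t : coker_sec V) :
  (forall W, coker_val s W = coker_val t W) -> s = t.
Proof.
case: s t => [s sP] [t tP] /= st.
have e : s = t by apply: functional_extensionality_dep.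
by subst t; congr CokerSec; exact: Prop_irrelevance.
Qed.

HB.instance Definition _ V := gen_eqMixin (coker_sec V).
HB.instance Definition _ V := gen_choiceMixin (coker_sec V).

Section Structure.
Variable V : opens X.
Implicit Types s t : coker_sec V.

Definition coker_zero : coker_sec V :=
  @CokerSec V (fun W => 0) (fun W W' h => coker_pres0 h).

Lemma coker_add_proof s t (W W' : cell_in V) (h : W' `<=` W) :
  coker_pres h (coker_val s W + coker_val t W) = coker_val s W' + coker_val t W'.
Proof. by rewrite coker_presD !coker_valP. Qed.
Definition coker_add s t := CokerSec (coker_add_proof s t).

Lemma coker_scale_proof (a : O V) s (W W' : cell_in V) (h : W' `<=` W) :
  coker_pres h (rres O (@cell_sub _ V W) a *: coker_val s W) =
  rres O (@cell_sub _ V W') a *: coker_val s W'.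
Proof.
by rewrite coker_presZ coker_valP (rres_comp _ h (@cell_sub _ V W')).
Qed.
Definition coker_scale a s := CokerSec (coker_scale_proof a s).

Lemma coker_addA : associative coker_add.
Proof. by move=> s t u; apply: coker_sec_eq => W; exact: addrA. Qed.
Lemma coker_addC : commutative coker_add.
Proof. by move=> s t; apply: coker_sec_eq => W; exact: addrC. Qed.
Lemma coker_add0 : left_id coker_zero coker_add.
Proof. by move=> s; apply: coker_sec_eq => W; exact: add0r. Qed.
Lemma coker_addN : left_inverse coker_zero (coker_scale (-1)) coker_add.
Proof.
by move=> s; apply: coker_sec_eq => W /=; rewrite rmorphN1 scaleN1r addNr.
Qed.

HB.instance Definition _ := GRing.isZmodule.Build (coker_sec V)
  coker_addA coker_addC coker_add0 coker_addN.

Lemma coker_scaleA a b s :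
  coker_scale a (coker_scale b s) = coker_scale (a * b) s.
Proof. by apply: coker_sec_eq => W /=; rewrite scalerA rmorphM. Qed.
Lemma coker_scale1 : left_id 1 coker_scale.
Proof. by move=> s; apply: coker_sec_eq => W /=; rewrite rmorph1 scale1r. Qed.
Lemma coker_scaleDr : right_distributive coker_scale +%R.
Proof. by move=> a s t; apply: coker_sec_eq => W /=; rewrite scalerDr. Qed.
Lemma coker_scaleDl s : {morph coker_scale^~ s : a b / a + b}.
Proof. by move=> a b; apply: coker_sec_eq => W /=; rewrite rmorphD scalerDl. Qed.

HB.instance Definition _ := GRing.Zmodule_isLmodule.Build (O V) (coker_sec V)
  coker_scaleA coker_scale1 coker_scaleDr coker_scaleDl.

End Structure.

Definition widen_cell (V V' : opens X) (V'V : V' `<=` V) (W : cell_in V') : cell_in V :=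
  CellIn (cell_ofP W) (subset_trans (@cell_sub _ V' W) V'V).

Definition coker_res (V V' : opens X) (V'V : V' `<=` V) (s : coker_sec V) :
    coker_sec V' :=
  @CokerSec V' (fun W => coker_val s (widen_cell V'V W))
    (fun W W' h => @coker_valP V s (widen_cell V'V W) (widen_cell V'V W') h).

Lemma coker_resD (U V : opens X) (VU : V `<=` U) (s t : coker_sec U) :
  coker_res VU (s + t) = coker_res VU s + coker_res VU t.
Proof. exact: coker_sec_eq. Qed.

Lemma coker_resZ (U V : opens X) (VU : V `<=` U) (a : O U) (s : coker_sec U) :
  coker_res VU (a *: s) = rres O VU a *: coker_res VU s.
Proof.
apply: coker_sec_eq => W /=.
by rewrite (rres_comp _ (@cell_sub _ V W) (@cell_sub _ U (widen_cell VU W))).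
Qed.

Lemma coker_val_irr (V W : opens X) (c c' : cell W) (h h' : W `<=` V)
    (s : coker_sec V) :
  coker_val s (CellIn c h) = coker_val s (CellIn c' h') :> Q W.
Proof. by rewrite (Prop_irrelevance c c') (Prop_irrelevance h h'). Qed.

Lemma coker_res_id (U : opens X) (UU : U `<=` U) s : coker_res UU s = s.
Proof.
by apply: coker_sec_eq => -[W cW WU] /=; exact: coker_val_irr.
Qed.

Lemma coker_res_comp (U V W : opens X) (VU : V `<=` U) (WV : W `<=` V)
  (WU : W `<=` U) s : coker_res WV (coker_res VU s) = coker_res WU s.
Proof.
by apply: coker_sec_eq => Z /=; exact: coker_val_irr.
Qed.

(** Each cell in [U] lies in a member of the cover that contains its point, so gluing reads each
    component off such a member. *)
Lemma coker_sheaf : is_sheaf coker_res.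
Proof.
move=> U I V VU cov s sc.
have loc (W : cell_in U) : exists i, W `<=` V i.
  have [x [Wx Wmin]] := cell_ofP W; have [i _ Vx] := cov x (@cell_sub _ U W x Wx).
  by exists i; exact: Wmin.
pose t (W : cell_in U) : Q W :=
  coker_val (s _) (CellIn (cell_ofP W) (svalP (cid (loc W)))).
(* The chosen member does not matter: compatibility is applied to the overlap [W] and read at the
   index [W] itself. *)
have tE i (W : cell_in U) (h : W `<=` V i) :
    t W = coker_val (s i) (CellIn (cell_ofP W) h).
  have := sc _ i W (svalP (cid (loc W))) h.
  move=> /(congr1 (fun r : coker_sec W =>
    coker_val r (CellIn (cell_ofP W) (@subset_refl _ W)))).
  by move=> e; apply: etrans (etrans _ e) _; rewrite /t /=; exact: coker_val_irr.
have tP (W W' : cell_in U) (h : W' `<=` W) : coker_pres h (t W) = t W'.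
  have [i Wi] := loc W; rewrite (tE i _ Wi) (tE i _ (subset_trans h Wi)).
  exact: (@coker_valP _ (s i) (CellIn (cell_ofP W) Wi)
           (CellIn (cell_ofP W') (subset_trans h Wi))).
exists (CokerSec tP); split=> [i|u us]; apply: coker_sec_eq => W.
  rewrite /= (tE i (widen_cell (VU i) W) (@cell_sub _ _ W)).
  by case: W => W cW WV; exact: coker_val_irr.
have [i Wi] := loc W; rewrite /= (tE i _ Wi) -(us i) /=.
by case: W Wi => W cW WU Wi; exact: coker_val_irr.
Qed.

Definition mod_coker : mod_sheaf O :=
  ModSheaf coker_resD coker_resZ coker_res_id coker_res_comp coker_sheaf.

Lemma coker_proj_proof V (y : N V) (W W' : cell_in V) (h : W' `<=` W) :
  coker_pres h (pi W (mres (@cell_sub _ V W) y)) = pi W' (mres (@cell_sub _ V W') y).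
Proof. by rewrite coker_presE (mres_comp _ _ (@cell_sub _ V W')). Qed.

Definition coker_proj_app V (y : N V) : mod_coker V :=
  CokerSec (coker_proj_proof y).

Lemma coker_proj_linear V : linear (@coker_proj_app V).
Proof.
by move=> a y z; apply: coker_sec_eq => W /=; rewrite mresD mresZ lpiD lpiZ.
Qed.

Lemma coker_proj_res (U V : opens X) (VU : V `<=` U) y :
  coker_proj_app (mres VU y) = mres VU (coker_proj_app y).
Proof.
apply: coker_sec_eq => W /=.
by rewrite (mres_comp _ _ (@cell_sub _ U (widen_cell VU W))).
Qed.

Definition coker_proj : mod_hom N mod_coker := ModHom coker_proj_linear coker_proj_res.

(** Over a cell [W] the index set of the limit has the greatest element [W], so a section is
    determined by its component in [lquot (f W)]. *)
Lemma coker_proj_cells : cell_exact f coker_proj /\ cell_surj coker_proj.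
Proof.
split=> W cW y; last first.
  have [n nE] := lpi_surj (coker_val y (CellIn cW (@subset_refl _ W))).
  exists n; apply: coker_sec_eq => W' /=.
  have := @coker_valP _ y (CellIn cW (@subset_refl _ W)) W' (@cell_sub _ W W').
  by rewrite -nE coker_presE.
split=> [/(congr1 (fun r : coker_sec W =>
  coker_val r (CellIn cW (@subset_refl _ W))))|[x <-]].
  by rewrite /= mres_id => /lpi_eq0.
apply: coker_sec_eq => W' /=; rewrite -happ_res; apply/lpi_eq0.
by eexists; reflexivity.
Qed.

End CokernelSheaf.

Section CokernelCells.
Variables (X : topologicalType) (O : ring_sheaf X).
Hypothesis hc : has_cells X.

(** Cokernels are unique up to isomorphism: [a] and [b] compare [c] with [coker_proj f], whose
    behaviour on cells is known. *)
Lemma cokernel_cells (M N K : mod_sheaf O) (f : mod_hom M N) (c : mod_hom N K) :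
  is_cokernel (C := mod_cat O) f c -> cell_exact f c /\ cell_surj c.
Proof.
move=> [cf0 cu]; have [ex surj] := coker_proj_cells f.
have [pf0 pu] := cell_cokernel hc ex surj.
have [a [/= ac _]] := cu _ (coker_proj f) pf0.
have [b [/= bp _]] := pu _ c cf0.
have ba : mod_comp b a = mod_id K.
  have [e [_ eu]] := cu _ c cf0; rewrite -(eu (mod_comp b a)) ?(eu (mod_id K)) //=.
    by rewrite mod_comp1f.
  by rewrite -mod_compA ac.
have acE W y : a W (c W y) = coker_proj f W y :=
  congr1 (fun h : mod_hom N (mod_coker f) => h W y) ac.
have bpE W y : b W (coker_proj f W y) = c W y :=
  congr1 (fun h : mod_hom N K => h W y) bp.
have baE W y : b W (a W y) = y := congr1 (fun h : mod_hom K K => h W y) ba.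
split=> W cW y.
  split=> [cy0|[x <-]]; first by apply/(ex W cW); rewrite -acE cy0 raddf0.
  exact: (congr1 (fun h : mod_hom M K => h W x) cf0).
by have [x xE] := surj W cW (a W y); exists x; rewrite -bpE xE baE.
Qed.

End CokernelCells.

(** * Quasi-coherence as base change *)

Lemma big_uniq_support (I : eqType) (V : nmodType) (F : I -> V) (D E : seq I) :
    uniq D -> uniq E -> (forall i, F i <> 0 -> i \in D) ->
    (forall i, F i <> 0 -> i \in E) ->
  \sum_(i <- D) F i = \sum_(i <- E) F i.
Proof.
move=> uD uE FD FE.
have red s : \sum_(i <- s) F i = \sum_(i <- [seq i <- s | `[< F i <> 0 >]]) F i.
  rewrite big_filter [RHS]big_mkcond; apply: eq_bigr => i _.
  by case: asboolP => // /contrapT.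
rewrite (red D) (red E); apply: perm_big; apply: uniq_perm; rewrite ?filter_uniq //.
by move=> i; rewrite !mem_filter; case: asboolP => //= Fi; rewrite FD ?FE.
Qed.

Section FreeSections.
Variables (X : topologicalType) (O : ring_sheaf X) (I : Type).

Definition unit_vec (U : opens X) (i : I) : I -> (O U)^o :=
  fun j => if `[< i = j >] then 1 else 0.

Lemma unit_vec_proof U i : unit_vec U i \in @free_pred X O I U.
Proof.
apply/asboolP => x Ux; exists U, (@subset_refl _ U); split=> //.
apply: sub_finite_set (finite_set1 i) => j /=; rewrite /unit_vec.
by case: asboolP => [->|_]; rewrite ?rmorph0.
Qed.

Definition free_unit (U : opens X) (i : I) : free_sec O I U :=
  FreeSec (unit_vec_proof U i).

Lemma free_res_unit (U V : opens X) (VU : V `<=` U) i :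
  free_res VU (free_unit U i) = free_unit V i.
Proof.
apply: val_inj; apply/funext => j /=; rewrite /unit_vec.
by case: asboolP => _; rewrite ?rmorph0 ?rmorph1.
Qed.

Lemma free_val_sum (U : opens X) (T : Type) (r : seq T) (F : T -> free_sec O I U) j :
  (\sum_(i <- r) F i) j = \sum_(i <- r) F i j.
Proof.
elim: r => [|i r IH]; first by rewrite !big_nil.
by rewrite !big_cons -IH.
Qed.

(** [I] is an arbitrary type; [{classic I}] gives it decidable equality, so that finite supports
    become duplicate-free lists. *)
Definition supported_on (U : opens X) (D : seq {classic I})
    (s : free_sec O I U) : Prop :=
  uniq D /\ forall i : {classic I}, s i <> 0 -> i \in D.

(** Finiteness near the point of a cell is finiteness on the cell: over a cell the sheaf direct sum
    is the direct sum of modules. *)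
Lemma free_support (W : opens X) (t : free_sec O I W) :
  cell W -> exists D, supported_on D t.
Proof.
move=> [x mW]; have /asboolP /(_ x (proj1 mW)) [V [VW [Vx]]] := free_valP t.
have e := cell_self mW VW Vx; subst V.
move=> /(@finite_seqP {classic I}) [D DE]; exists (undup D); split=> [|i ti].
  exact: undup_uniq.
have : [set` D] i by rewrite -DE /= rres_id.
by rewrite mem_undup.
Qed.

Lemma free_expand (U : opens X) (D : seq {classic I}) (t : free_sec O I U) :
  supported_on D t -> t = \sum_(i <- D) t i *: free_unit U i.
Proof.
move=> [uD tD]; apply: val_inj; apply/funext => j; rewrite [RHS]free_val_sum.
have E i : (t i *: free_unit U i) j = if `[< i = j >] then t j else 0.
  rewrite -[LHS]/(t i * unit_vec U i j) /unit_vec.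
  by case: asboolP => [->|_]; rewrite ?mulr1 ?mulr0.
under eq_bigr do rewrite E.
have [jD|jD] := boolP ((j : {classic I}) \in D); last first.
  rewrite big1_seq => [|i /= iD]; first by apply: contrapT => /tD; rewrite (negbTE jD).
  by case: asboolP => // ij; move: jD; rewrite -ij iD.
rewrite (bigD1_seq (j : {classic I})) //= asboolT // big1 ?addr0 // => i /eqP ij.
by rewrite asboolF.
Qed.

Lemma mres_semilinear (M : mod_sheaf O) (U V : opens X) (VU : V `<=` U) :
  semilinear_along (rres O VU) (@mres _ _ M _ _ VU).
Proof. by split=> [s t|a s]; [exact: mresD|exact: mresZ]. Qed.

(** Both orders appear so that two sections, supported on [D] and on [E], can share the list
    [undup (D ++ E)]. *)
Lemma supported_on_cat (U : opens X) (D E : seq {classic I}) (s : free_sec O I U) :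
  supported_on D s ->
  supported_on (undup (D ++ E)) s /\ supported_on (undup (E ++ D)) s.
Proof.
by move=> [_ sD]; split; split=> [|i /sD iD];
  rewrite ?undup_uniq // mem_undup mem_cat iD ?orbT.
Qed.

End FreeSections.

Definition flat_cells (X : topologicalType) (O : ring_sheaf X) : Prop :=
  forall (V W : opens X) (WV : W `<=` V), cell V -> cell W -> is_flat (rres O WV).

Definition qc_cells (X : topologicalType) (O : ring_sheaf X) (M : mod_sheaf O) : Prop :=
  forall (V W : opens X) (WV : W `<=` V), cell V -> cell W ->
    base_change (rres O WV) (@mres _ _ M _ _ WV).

Section QcCells.
Variables (X : topologicalType) (O : ring_sheaf X).
Hypothesis hc : has_cells X.
Implicit Types M N K : mod_sheaf O.

Lemma qc_cells_free (I : Type) : qc_cells (free_mod O I).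
Proof.
move=> V W WV cV cW; have r_semi := mres_semilinear (free_mod O I) WV.
(* [sigma D] inverts the comparison map on tensors involving only indices in D. *)
pose sigma (D : seq {classic I}) (t : free_sec O I W) :
    tensor (free_sec O I V) (restrict_scalars (rres O WV)) :=
  \sum_(i <- D) tpure (free_unit O V i) (t i : restrict_scalars (rres O WV)).
have ext_sigma D t : supported_on D t ->
    scalar_ext (phi := rres O WV) (@mres _ _ (free_mod O I) _ _ WV) (sigma D t) = t.
  move=> Dt; rewrite /sigma scalar_ext_sum // [RHS](free_expand Dt).
  by apply: eq_bigr => i _; rewrite scalar_ext_pure // [mres _ _]free_res_unit.
split=> [t|x x0].
  by have [D Dt] := free_support t cW; exists (sigma D t); exact: ext_sigma.
(* Quantifying over every list [E] that contains [D] lets the terms of a sum of tensors share one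
   list in the induction. *)
suff [D DE] : exists D : seq {classic I}, forall E, uniq E -> {subset D <= E} ->
    x = sigma E (scalar_ext (phi := rres O WV) (@mres _ _ (free_mod O I) _ _ WV) x).
  rewrite (DE (undup D)) ?undup_uniq // => [|i]; last by rewrite mem_undup.
  by rewrite x0 /sigma big1 // => i _; exact: tpure0r.
elim/tensor_ind: x {x0} => [|m b x [D DE]].
  by exists [::] => E _ _; rewrite scalar_ext0 // /sigma big1 // => i _; exact: tpure0r.
have [Dm [_ mD]] := free_support m cV; exists (Dm ++ D) => E uE DmE.
rewrite scalar_extD // /sigma; under eq_bigr do rewrite tpureDr.
rewrite big_split /=; congr (_ + _); last first.
  by apply: DE => // i iD; apply: DmE; rewrite mem_cat iD orbT.
have mE : supported_on E m.
  by split=> // i /mD iD; apply: DmE; rewrite mem_cat iD.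
rewrite {1}(free_expand mE) tpure_suml; apply: eq_bigr => i _.
rewrite tpureZ scalar_ext_pure //; congr (tpure _ _).
by rewrite [LHS]mulrC.
Qed.

Hypothesis flat : flat_cells O.

Section ShortExact.
Variables (M N K : mod_sheaf O) (f : mod_hom M N) (g : mod_hom N K).
Hypothesis ex : cell_exact f g.

Lemma qc_cells_kernel : cell_inj f -> qc_cells N -> qc_cells K -> qc_cells M.
Proof.
move=> inj qN qK V W WV cV cW.
apply: (@base_change_kernel _ _ _ _ _ _ _ _ _ _
  (@mres _ _ N _ _ WV) (@mres _ _ K _ _ WV)
  (f V) (g V) (f W) (g W));
  try exact: mres_semilinear; try (by move=> s; exact: happ_res);
  by [exact: flat|exact: ex|exact: inj|exact: qN|exact: qK].
Qed.

Lemma qc_cells_cokernel : cell_surj g -> qc_cells M -> qc_cells N -> qc_cells K.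
Proof.
move=> surj qM qN V W WV cV cW.
apply: (@base_change_cokernel _ _ _ _ _ _ _ _ _
  (@mres _ _ M _ _ WV) (@mres _ _ N _ _ WV) _
  (f V) (g V) (f W) (g W));
  try exact: mres_semilinear; try (by move=> s; exact: happ_res);
  by [exact: flat|exact: ex|exact: surj|exact: qM|exact: qN].
Qed.

Lemma qc_cells_extension :
  cell_inj f -> cell_surj g -> qc_cells M -> qc_cells K -> qc_cells N.
Proof.
move=> inj surj qM qK V W WV cV cW.
apply: (@base_change_middle _ _ _ _ _ _ _ _ _
  (@mres _ _ M _ _ WV) _ (@mres _ _ K _ _ WV)
  (f V) (g V) (f W) (g W));
  try exact: mres_semilinear; try (by move=> s; exact: happ_res);
  by [exact: flat|exact: ex|exact: inj|exact: surj|exact: qM|exact: qK].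
Qed.

End ShortExact.

Lemma qc_cells_mod_kernel M N (f : mod_hom M N) :
  qc_cells M -> qc_cells N -> qc_cells (mod_kernel f).
Proof.
by have [inj ex] := kernel_incl_cells f; exact: (qc_cells_kernel ex).
Qed.

Lemma qc_cells_mod_coker M N (f : mod_hom M N) :
  qc_cells M -> qc_cells N -> qc_cells (mod_coker f).
Proof.
by have [ex surj] := coker_proj_cells f; exact: (qc_cells_cokernel ex).
Qed.

(** * Presentations over a space that is itself a cell *)

Section Top.
Variable T : opens X.
Hypotheses (cT : cell T) (topT : forall W : opens X, W `<=` T).

(** On a cell the value is a finite linear combination of the restricted [n i], over any list
    containing the support; [Sirr] makes the list irrelevant. *)
Lemma free_hom (I : Type) N (n : I -> N T) :
  exists g : mod_hom (free_mod O I) N, forall W, cell W ->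
    forall i, g W (free_unit O W i) = mres (@topT W) (n i).
Proof.
pose S W (D : seq {classic I}) (t : free_sec O I W) :=
  \sum_(i <- D) (t i : O W) *: mres (@topT W) (n i).
have Sirr W (D E : seq {classic I}) (t : free_sec O I W) :
    supported_on D t -> supported_on E t -> S W D t = S W E t.
  move=> [uD tD] [uE tE]; apply: big_uniq_support => // i nz;
  by [apply: tD => t0; apply: nz; rewrite t0 scale0r|
      apply: tE => t0; apply: nz; rewrite t0 scale0r].
have [||||g gP] := @hom_of_rel _ hc _ (free_mod O I) N
    (fun W t u => exists2 D : seq {classic I}, supported_on D t & S W D t = u).
- by move=> W t cW; have [D Dt] := free_support t cW; exists (S W D t), D.
- by move=> W t u u' cW [D Dt <-] [E Et <-]; exact: Sirr.
- move=> W a t t' _ _ cW [D Dt <-] [E Et' <-].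
  have [Dt1 _] := supported_on_cat E Dt; have [_ Et1] := supported_on_cat D Et'.
  exists (undup (D ++ E)).
    split=> [|i ne]; first exact: undup_uniq.
    have [[_ tP] [_ tP']] := (Dt1, Et1); apply: contrapT => iD; apply: ne.
    rewrite -[(a *: t + t') i]/(a * t i + t' i).
    have -> : t i = 0 by apply: contrapT => /tP.
    have -> : t' i = 0 by apply: contrapT => /tP'.
    by rewrite mulr0 addr0.
  rewrite (Sirr _ _ _ _ Dt Dt1) (Sirr _ _ _ _ Et' Et1) /S scaler_sumr -big_split /=.
  by apply: eq_bigr => i _; rewrite scalerA -scalerDl.
- move=> V W WV t _ cV cW [D [uD tD] <-]; exists D.
    split=> // i ne; apply: tD => t0; apply: ne.
    by rewrite -[LHS]/(rres O WV (t i)) t0 rmorph0.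
  rewrite (semilinear_sum (mres_semilinear N WV)); apply: eq_bigr => i _.
  by rewrite mresZ (mres_comp _ WV (@topT W)).
exists g => W cW i; have [D Di <-] := gP W (free_unit O W i) cW.
have i1 : supported_on [:: i : {classic I}] (free_unit O W i).
  split=> // j; rewrite /= /unit_vec mem_seq1; case: asboolP => // -> _.
  exact: eqxx.
by rewrite (Sirr _ _ _ _ Di i1) /S big_seq1 /= /unit_vec asboolT // scale1r.
Qed.

Lemma qc_cells_generated M W (y : M W) : qc_cells M -> cell W ->
  exists s : seq (M T * O W), y = \sum_(mb <- s) mb.2 *: mres (@topT W) mb.1.
Proof.
by move=> qM cW; have [/(_ y) [x <-] _] := qM T W (@topT W) cT cW; exists (trepr x).
Qed.

(** The generators are all sections of [M] over [T], the relations all sections over [T] of the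
    kernel of [c]. Surjectivity in base change, for [M] and for the kernel, says that these generate
    over every cell. *)
Lemma qc_cells_presented M : qc_cells M ->
  exists (I J : Type) (f : mod_hom (free_mod O J) (free_mod O I))
    (c : mod_hom (free_mod O I) M), is_cokernel (C := mod_cat O) f c.
Proof.
move=> qM; have [c cE] := free_hom (fun m : M T => m).
have qK := qc_cells_mod_kernel c (qc_cells_free _) qM.
have [f fE] := free_hom (fun k : mod_kernel c T => ker_val k).
exists (M T), (mod_kernel c T), f, c.
apply: (cell_cokernel hc) => W cW y; last first.
  have [s ->] := qc_cells_generated y qM cW.
  exists (\sum_(mb <- s) mb.2 *: free_unit O W mb.1); rewrite linear_sum /=.
  by apply: eq_bigr => mb _; rewrite linearZ /= cE.
split=> [/eqP cy|[x <-]].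
  have [s /(congr1 (kernel_incl c W))] :=
    qc_cells_generated (KerSec (f := c) (U := W) cy : mod_kernel c W) qK cW.
  rewrite linear_sum /= => ->.
  exists (\sum_(kb <- s) kb.2 *: free_unit O W kb.1); rewrite linear_sum /=.
  by apply: eq_bigr => kb _; rewrite linearZ /= fE.
have [D Dx] := free_support x cW; rewrite (free_expand Dx) !linear_sum /=.
rewrite big1 // => k _; rewrite !linearZ /= fE // happ_res.
by rewrite (eqP (ker_valP (k : mod_kernel c T))) mres0 scaler0.
Qed.

End Top.
End QcCells.

(** * Cells of an open subspace *)

Section RestrictionCells.
Variables (X : topologicalType) (U : opens X).

Lemma minimal_push (V : opens (set_type U)) (y : set_type U) :
  minimal_at V y <-> minimal_at (push V) (set_val y).
Proof.
split=> [[Vy Vmin]|[[y' Vy' /val_inj <-] Vmin]]; split=> //.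
- by exists y.
- move=> Z Zy _ [z Vz <-]; have oZ : open (set_val @^-1` Z : set (set_type U)).
    by exists Z => //; exact: carrier_open.
  exact: (Vmin (Opens oZ)).
- move=> W Wy; apply: sub_push; apply: Vmin; by exists y'.
Qed.

Lemma cell_push (V : opens (set_type U)) : cell V <-> cell (push V).
Proof.
split=> [[y /minimal_push my]|[x mx]]; first by exists (set_val y).
by have [y _ yx] := proj1 mx; exists y; apply/minimal_push; rewrite yx.
Qed.

Lemma has_cells_restrict : has_cells X -> has_cells (set_type U).
Proof.
move=> hc y; have [W mW] := hc (set_val y).
have [|W' WE] := @push_onto X U W; first by apply: (proj2 mW); exact: set_valP.
by exists W'; apply/minimal_push; rewrite -WE.
Qed.

Variable O : ring_sheaf X.

Lemma flat_cells_restrict : flat_cells O -> flat_cells (ring_restrict U O).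
Proof. by move=> flat V W WV /cell_push cV /cell_push cW; exact: flat. Qed.

Lemma qc_cells_restrict (M : mod_sheaf O) : qc_cells M -> qc_cells (mod_restrict U M).
Proof. by move=> qM V W WV /cell_push cV /cell_push cW; exact: qM. Qed.

End RestrictionCells.

Lemma quasi_coherentP (X : topologicalType) (O : ring_sheaf X) (M : mod_sheaf O) :
  has_cells X -> flat_cells O -> quasi_coherent M <-> qc_cells M.
Proof.
move=> hc flat; split=> [qM V W WV cV cW|qM x].
  (* By minimality [V] lies in the neighbourhood [U] of its point that carries the presentation, so
     [V] and [W] both come from open sets of [U]. *)
  have [x [Vx Vmin]] := cV.
  have [U [Ux [I [J [f [c fc]]]]]] := qM x; have VU := Vmin U Ux.
  have [V' VE] := push_onto VU; have [W' WE] := push_onto (subset_trans WV VU).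
  subst V W; have hcU := has_cells_restrict (U := U) hc.
  have [ex surj] := cokernel_cells hcU fc.
  have := qc_cells_cokernel (flat_cells_restrict flat) ex surj
    (qc_cells_free _ _) (qc_cells_free _ _).
  move=> /(_ V' W' (sub_push WV)).
  rewrite /= (Prop_irrelevance (push_sub (sub_push WV)) WV).
  by apply; apply/cell_push.
(* The cell [U] at [x] becomes the whole [T] of the subspace, again a cell there. *)
have [U [Ux Umin]] := hc x; exists U; split=> //.
have [T TU] := @push_onto X U U (@subset_refl _ U).
apply: (qc_cells_presented (T := T) (has_cells_restrict hc) (flat_cells_restrict flat)).
- by apply/cell_push; rewrite -TU; exists x.
- by move=> W; apply: sub_push; rewrite -TU => _ [y _ <-]; exact: set_valP.
- exact: qc_cells_restrict.
Qed.

(** * Abelian subcategory *)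

Section DirectSum.
Variables (X : topologicalType) (O : ring_sheaf X) (M N : mod_sheaf O).

Definition sum_res (U V : opens X) (VU : V `<=` U) (s : (M U * N U)%type) :
  (M V * N V)%type := (mres VU s.1, mres VU s.2).

Lemma sum_resD (U V : opens X) (VU : V `<=` U) s t :
  sum_res VU (s + t) = sum_res VU s + sum_res VU t.
Proof. by rewrite /sum_res /= !mresD. Qed.

Lemma sum_resZ (U V : opens X) (VU : V `<=` U) (a : O U) s :
  sum_res VU (a *: s) = rres O VU a *: sum_res VU s.
Proof. by rewrite /sum_res /= !mresZ. Qed.

Lemma sum_res_id (U : opens X) (UU : U `<=` U) s : sum_res UU s = s.
Proof. by case: s => s t; rewrite /sum_res /= !mres_id. Qed.

Lemma sum_res_comp (U V W : opens X) (VU : V `<=` U) (WV : W `<=` V)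
  (WU : W `<=` U) s : sum_res WV (sum_res VU s) = sum_res WU s.
Proof. by rewrite /sum_res /= !(mres_comp _ _ WU). Qed.

Lemma sum_sheaf : is_sheaf sum_res.
Proof.
move=> U I V VU cov s sc.
have [i j W Wi Wj|t [ts tu]] := @msec_sheaf _ _ M U I V VU cov (fun i => (s i).1).
  by have [] := sc i j W Wi Wj.
have [i j W Wi Wj|u [us uu]] := @msec_sheaf _ _ N U I V VU cov (fun i => (s i).2).
  by have [] := sc i j W Wi Wj.
exists (t, u); split=> [i|[t' u'] tu's].
  by rewrite /sum_res /= ts us -surjective_pairing.
by rewrite (tu t') ?(uu u') // => i; rewrite -(tu's i).
Qed.

Definition mod_sum : mod_sheaf O :=
  @ModSheaf X O (fun U => (M U * N U)%type) sum_res sum_resD sum_resZ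
    sum_res_id sum_res_comp sum_sheaf.

Definition sum_fst : mod_hom mod_sum M :=
  @ModHom _ _ mod_sum M (fun U s => s.1) (fun U a s t => erefl) (fun U V VU s => erefl).
Definition sum_snd : mod_hom mod_sum N :=
  @ModHom _ _ mod_sum N (fun U s => s.2) (fun U a s t => erefl) (fun U V VU s => erefl).

Lemma sum_inl_linear U : linear (fun s : M U => (s, 0) : mod_sum U).
Proof. by move=> a s t; rewrite -[RHS]/(a *: s + t, a *: 0 + 0) scaler0 addr0. Qed.
Lemma sum_inl_res (U V : opens X) (VU : V `<=` U) (s : M U) :
  (mres VU s, 0) = mres VU ((s, 0) : mod_sum U) :> mod_sum V.
Proof. by rewrite /= /sum_res /= mres0. Qed.
Definition sum_inl : mod_hom M mod_sum := ModHom sum_inl_linear sum_inl_res.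

Lemma sum_inr_linear U : linear (fun s : N U => (0, s) : mod_sum U).
Proof. by move=> a s t; rewrite -[RHS]/(a *: 0 + 0, a *: s + t) scaler0 addr0. Qed.
Lemma sum_inr_res (U V : opens X) (VU : V `<=` U) (s : N U) :
  (0, mres VU s) = mres VU ((0, s) : mod_sum U) :> mod_sum V.
Proof. by rewrite /= /sum_res /= mres0. Qed.
Definition sum_inr : mod_hom N mod_sum := ModHom sum_inr_linear sum_inr_res.

Lemma sum_product : is_product (C := mod_cat O) sum_fst sum_snd.
Proof.
move=> T f g.
have hl U : linear (fun s : T U => (f U s, g U s) : mod_sum U).
  by move=> a s t; rewrite !happ_linear.
have hr (U V : opens X) (VU : V `<=` U) (s : T U) :
    (f V (mres VU s), g V (mres VU s)) = mres VU ((f U s, g U s) : mod_sum U).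
  by rewrite !happ_res.
exists (ModHom hl hr); split=> [|h [hf hg]]; first by split; exact: mod_hom_eq.
by apply: mod_hom_eq => U s /=; rewrite -hf -hg /= /comp_app /= -surjective_pairing.
Qed.

Lemma sum_coproduct : is_coproduct (C := mod_cat O) sum_inl sum_inr.
Proof.
move=> T f g.
have hl U : linear (fun s : mod_sum U => f U s.1 + g U s.2).
  by move=> a s t; rewrite !happ_linear scalerDr addrACA.
have hr (U V : opens X) (VU : V `<=` U) (s : mod_sum U) :
    f V (mres VU s).1 + g V (mres VU s).2 = mres VU (f U s.1 + g U s.2).
  by rewrite mresD !happ_res.
exists (ModHom hl hr); split=> [|h [hf hg]].
  by split; apply: mod_hom_eq => U s; rewrite /= /comp_app /= raddf0 ?addr0 ?add0r.
apply: mod_hom_eq => U [s t] /=; rewrite -hf -hg /= /comp_app -raddfD /=.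
by congr (h U (_, _)); rewrite /= ?addr0 ?add0r.
Qed.

End DirectSum.

(** An equation between morphisms means the same in a full subcategory, unlike a universal
    property. *)
Lemma zero_object_id (C : category) (Z : C) : idc Z = zeroc <-> is_zero_object Z.
Proof.
split=> [Z0|[to _]];
  last by have [f [_ fu]] := to Z; rewrite -(fu (idc Z)) // (fu zeroc).
split=> A; exists zeroc; split=> // f _; first by rewrite -(comp1f f) Z0 comp0f.
by rewrite -(compf1 f) Z0 compf0.
Qed.

(** * Universal objects in a full subcategory *)

Section FullSubcategory.
Variables (C : category) (P : C -> Prop).
Local Notation D := (full_subcategory P).

Lemma full_zero_object (Z : D) : is_zero_object Z <-> is_zero_object (sval Z).
Proof.
by split=> /zero_object_id Z0; apply/zero_object_id; exact: Z0.
Qed.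

(** The product [Q'] of [C] lies in the subcategory. The comparison [h] after [k] is the identity of
    [Q], so factorizations through [Q'] transport to [Q], with uniqueness. *)
Lemma full_product (A B Q Q' : D) (p : homc Q A) (q : homc Q B)
    (p' : homc Q' A) (q' : homc Q' B) :
  is_product (C := C) (p' : homc (sval Q') (sval A)) q' -> is_product p q ->
  is_product (C := C) (p : homc (sval Q) (sval A)) q.
Proof.
move=> up' up; have [k [[/= pk qk] _]] := up' _ p q.
have [h [[/= ph qh] _]] := up _ p' q'.
have hk : @compc C _ _ _ h k = idc (sval Q).
  have [e [_ eu]] := up _ p q; rewrite -(eu (@compc C _ _ _ h k)) ?(eu (idc _)) //=.
    by rewrite !compf1.
  by rewrite !Defs.compA ph qh pk qk.
move=> T f g; have [t [[pt qt] tu]] := up' T f g.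
exists (@compc C _ _ _ h t); split=> [|u [pu qu]].
  by rewrite !Defs.compA ph qh pt qt.
rewrite (tu (@compc C _ _ _ k u)); first by rewrite Defs.compA hk comp1f.
by rewrite !Defs.compA pk qk pu qu.
Qed.

Lemma full_kernel (A B K K' : D) (f : homc A B) (k : homc K A) (k' : homc K' A) :
  is_kernel (C := C) (f : homc (sval A) (sval B)) k' -> is_kernel f k ->
  is_kernel (C := C) (f : homc (sval A) (sval B)) k.
Proof.
move=> [fk'0 uk'] [fk0 uk]; have [h [/= kh _]] := uk _ k' fk'0.
have [j [/= k'j _]] := uk' _ k fk0.
have hj : @compc C _ _ _ h j = idc (sval K).
  have [e [_ eu]] := uk _ k fk0; rewrite -(eu (@compc C _ _ _ h j)) ?(eu (idc _)) //=.
    by rewrite compf1.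
  by rewrite Defs.compA kh.
split=> // T t ft; have [u [k'u uu]] := uk' T t ft.
exists (@compc C _ _ _ h u); split=> [|v kv]; first by rewrite Defs.compA kh.
rewrite (uu (@compc C _ _ _ j v)); first by rewrite Defs.compA hj comp1f.
by rewrite Defs.compA k'j.
Qed.

End FullSubcategory.

(** Duality: coproducts and cokernels are products and kernels in [opposite C], by conversion. *)
Definition opposite (C : category) : category :=
  @Category C (fun A B : C => homc B A) (fun A : C => idc A)
    (fun (A B D : C) g f => compc f g) (fun A B : C => zeroc)
    (fun (A B D E : C) h g f => esym (Defs.compA f g h))
    (fun (A B : C) f => compf1 f) (fun (A B : C) f => comp1f f)
    (fun (A B D : C) f => compf0 _ f) (fun (A B D : C) f => comp0f _ f).

Lemma full_coproduct (C : category) (P : C -> Prop) (A B Q Q' : full_subcategory P)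
    (i : homc A Q) (j : homc B Q) (i' : homc A Q') (j' : homc B Q') :
  is_coproduct (C := C) (i' : homc (sval A) (sval Q')) j' -> is_coproduct i j ->
  is_coproduct (C := C) (i : homc (sval A) (sval Q)) j.
Proof. exact: (@full_product (opposite C) P A B Q Q' i j i' j'). Qed.

Lemma full_cokernel (C : category) (P : C -> Prop) (A B K K' : full_subcategory P)
    (f : homc A B) (c : homc B K) (c' : homc B K') :
  is_cokernel (C := C) (f : homc (sval A) (sval B)) c' -> is_cokernel f c ->
  is_cokernel (C := C) (f : homc (sval A) (sval B)) c.
Proof. exact: (@full_kernel (opposite C) P B A K K' f c c'). Qed.

(** * The subcategory of modules with base change on cells *)

Section QcSubcategory.
Variables (X : topologicalType) (O : ring_sheaf X).
Hypotheses (hc : has_cells X) (flat : flat_cells O).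
Implicit Types M N : mod_sheaf O.

(** The direct sum is an extension of [N] by [M]. *)
Lemma qc_cells_sum M N : qc_cells M -> qc_cells N -> qc_cells (mod_sum M N).
Proof.
apply: (@qc_cells_extension _ O flat _ _ _ (sum_inl M N) (sum_snd M N)).
- move=> W _ [s t] /=; split=> [->|[u [_ <-]]] //; by exists s.
- by move=> W _ s t [].
- by move=> W _ t; exists (0, t).
Qed.

Lemma free_void_zero : is_zero_object (C := mod_cat O) (free_mod O void).
Proof.
by apply/zero_object_id; apply: mod_hom_eq => U s; apply: val_inj; apply/funext => -[].
Qed.

Local Notation qc := (@qc_cells X O).
Local Notation D := (full_subcategory (C := mod_cat O) qc).

Let sum_obj (A B : D) : D :=
  exist (fun M : mod_cat O => qc M) (mod_sum (sval A) (sval B))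
    (qc_cells_sum (svalP A) (svalP B)).
Let ker_obj (A B : D) (f : homc A B) : D :=
  exist (fun M : mod_cat O => qc M) (mod_kernel (f : mod_hom (sval A) (sval B)))
    (qc_cells_mod_kernel flat f (svalP A) (svalP B)).
Let coker_obj (A B : D) (f : homc A B) : D :=
  exist (fun M : mod_cat O => qc M) (mod_coker (f : mod_hom (sval A) (sval B)))
    (qc_cells_mod_coker flat f (svalP A) (svalP B)).

Lemma coker_projP M N (f : mod_hom M N) :
  is_cokernel (C := mod_cat O) f (coker_proj f).
Proof. by have [ex surj] := coker_proj_cells f; exact: cell_cokernel. Qed.

(** [f] is a mono with respect to objects of the subcategory only; its kernel is one of them, so the
    inclusion of the kernel is forced to vanish. *)
Lemma qc_mono_inj (A B : D) (f : homc A B) : is_mono f ->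
  cell_inj (f : mod_hom (sval A) (sval B)).
Proof.
move=> mono; apply: cell_injP => W _ s /eqP fs.
have /= k0 := mono (ker_obj f) (kernel_incl (f : mod_hom (sval A) (sval B))) zeroc.
rewrite mod_compf0 in k0; have {}k0 := k0 (proj1 (kernelP _)).
exact: (congr1 (fun h : mod_hom (mod_kernel f) (sval A) =>
  h W (KerSec (f := f) fs)) k0).
Qed.

Lemma qc_epi_surj (A B : D) (f : homc A B) : is_epi f ->
  cell_surj (f : mod_hom (sval A) (sval B)).
Proof.
move=> epi W cW y; have [ex _] := coker_proj_cells (f : mod_hom (sval A) (sval B)).
have /= c0 := epi (coker_obj f) (coker_proj (f : mod_hom (sval A) (sval B))) zeroc.
rewrite mod_comp0f in c0; have {}c0 := c0 (proj1 (coker_projP _)).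
apply/(ex W cW).
exact: (congr1 (fun h : mod_hom (sval B) (mod_coker f) => h W y) c0).
Qed.

(** By exactness on cells a mono is the kernel of its cokernel and an epi the cokernel of its
    kernel. The inclusion is exact because the constructions made in [mod_cat O] already land in
    [qc]. *)
Lemma qc_cells_abelian : abelian_subcategory (C := mod_cat O) qc.
Proof.
split; first split.
- by exists (exist _ _ (qc_cells_free O void)); apply/full_zero_object/free_void_zero.
- move=> A B; exists (sum_obj A B),
    (sum_fst (sval A) (sval B)), (sum_snd (sval A) (sval B)).
  by move=> T; exact: sum_product.
- move=> A B; exists (sum_obj A B),
    (sum_inl (sval A) (sval B)), (sum_inr (sval A) (sval B)).
  by move=> T; exact: sum_coproduct.
- move=> A B f; exists (ker_obj f), (kernel_incl (f : mod_hom (sval A) (sval B))).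
  by have [k0 ku] := kernelP (f : mod_hom (sval A) (sval B)); split=> // T; exact: ku.
- move=> A B f; exists (coker_obj f), (coker_proj (f : mod_hom (sval A) (sval B))).
  have [c0 cu] := coker_projP (f : mod_hom (sval A) (sval B)).
  by split=> // T; exact: cu.
- move=> A B f /qc_mono_inj inj.
  exists (coker_obj f), (coker_proj (f : mod_hom (sval A) (sval B))).
  have [ex _] := coker_proj_cells (f : mod_hom (sval A) (sval B)).
  by have [k0 ku] := cell_kernel hc inj ex; split=> // T; exact: ku.
- move=> A B f /qc_epi_surj surj.
  exists (ker_obj f), (kernel_incl (f : mod_hom (sval A) (sval B))).
  have [_ ex] := kernel_incl_cells (f : mod_hom (sval A) (sval B)).
  by have [c0 cu] := cell_cokernel hc ex surj; split=> // T; exact: cu.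
- by move=> Z /full_zero_object.
- move=> A B Q p q; apply: (@full_product (mod_cat O) qc A B Q (sum_obj A B) p q
    (sum_fst (sval A) (sval B)) (sum_snd (sval A) (sval B))).
  exact: sum_product.
- move=> A B Q i j; apply: (@full_coproduct (mod_cat O) qc A B Q (sum_obj A B) i j
    (sum_inl (sval A) (sval B)) (sum_inr (sval A) (sval B))).
  exact: sum_coproduct.
- move=> A B K f k; apply: (@full_kernel (mod_cat O) qc A B K (ker_obj f) f k
    (kernel_incl (f : mod_hom (sval A) (sval B)))).
  exact: kernelP.
- move=> A B K f c; apply: (@full_cokernel (mod_cat O) qc A B K (coker_obj f) f c
    (coker_proj (f : mod_hom (sval A) (sval B)))).
  exact: coker_projP.
Qed.

End QcSubcategory.

(** * Cells of a finite space *)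

Section FiniteSpaceCells.
Variables (X : topologicalType) (finX : finite_set [set: X]).

Lemma min_open_minimal p : minimal_at (min_open finX p) p.
Proof.
split=> [W [] //|V Vp x]; apply; split=> //; exact: carrier_open.
Qed.

Lemma finite_has_cells : has_cells X.
Proof. by move=> p; exists (min_open finX p); exact: min_open_minimal. Qed.

Lemma minimal_atE W p : minimal_at W p -> W = min_open finX p.
Proof.
move=> [Wp Wmin]; apply: (cell_self (min_open_minimal p)) => //.
by apply: Wmin; exact: proj1 (min_open_minimal p).
Qed.

(** [finite_space] speaks of the sets [min_open finX p]; every cell equals one of them. *)
Lemma finite_space_flat (O : ring_sheaf X) : finite_space finX O -> flat_cells O.
Proof.
move=> flat V W WV [p /minimal_atE VE] [q /minimal_atE WE]; subst V W.
have pq : spec_le finX p q by apply: WV; exact: proj1 (min_open_minimal q).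
by rewrite (Prop_irrelevance WV (min_open_sub pq)); exact: flat.
Qed.

End FiniteSpaceCells.

Unset Implicit Arguments.

Theorem proposition3p2 (X : topologicalType) (finX : finite_set [set: X])
    (O : ring_sheaf X) (flatO : finite_space finX O) :
  (forall (M N : mod_sheaf O) (f : mod_hom M N),
     quasi_coherent M -> quasi_coherent N -> quasi_coherent (mod_kernel f)) /\
  (forall (M' M M'' : mod_sheaf O) (i : mod_hom M' M) (p : mod_hom M M''),
     short_exact i p ->
     [/\ quasi_coherent M' -> quasi_coherent M -> quasi_coherent M'',
         quasi_coherent M' -> quasi_coherent M'' -> quasi_coherent M
       & quasi_coherent M -> quasi_coherent M'' -> quasi_coherent M']) /\
  abelian_subcategory (C := mod_cat O) (@quasi_coherent X O).
Proof.
have hc := finite_has_cells finX; have flat := finite_space_flat flatO.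
(* Equality of the predicates, beyond pointwise equivalence, allows rewriting inside the full
   subcategory as well. *)
have -> : @quasi_coherent X O = @qc_cells X O.
  by apply/funext => M; apply/propext; exact: quasi_coherentP.
split; first by move=> M N f; exact: qc_cells_mod_kernel.
split=> [M' M M'' i p /short_exact_cells [inj ex surj]|]; last exact: qc_cells_abelian.
split; [exact: qc_cells_cokernel ex surj|exact: qc_cells_extension ex inj surj|].
exact: qc_cells_kernel ex inj.
Qed.
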